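(* Let $F=f+\psi$ and let $\{x_k\}_{k\ge 0}$ be the iterates of the Super-Universal Newton Method (described in the context) with parameters $\alpha\in[\tfrac23,1]$ and $H_0>0$ satisfying $H_0\le\mathcal H_\alpha(g_0)$. Assume that the initial sublevel set $\mathcal F_0=\{x\in\operatorname{dom}\psi:\ F(x)\le F(x_0)\}$ is bounded, with $D=\sup_{x,y\in\mathcal F_0}\|x-y\|<+\infty$. Let $\varepsilon>0$ and assume that $k\ge1$ satisfies $k\ge4\ln\frac{g_0D}{\varepsilon}$. (1) If the third derivative is Lipschitz continuous ($q=4$), we obtain the same convergence rate as that of the third-order Tensor Method: $$F(x_k)-F_*\le O\Bigl(\frac{M_4D^4}{k^3}\Bigr).$$ (2) If the Hessian is Lipschitz continuous ($q=3$), then the method achieves the same convergence rate as the Cubic Newton Method: $$F(x_k)-F_*\le O\Bigl(\frac{M_3D^3}{k^2}\Bigr).$$ (3) If the Hessian has bounded variation ($q=2$), then the rate is $$F(x_k)-F_*\le O\Bigl(\frac{M_2D^2}{k}\Bigr).$$ Here $O(\cdot)$ hides absolute constants.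
   Context: Spaces and norms. $\mathbb E$ is a finite-dimensional real vector space, $\mathbb E^*$ its dual, $\langle s,x\rangle$ the value of $s\in\mathbb E^*$ at $x\in\mathbb E$. $B:\mathbb E\to\mathbb E^*$ is a fixed self-adjoint positive-definite linear operator; $\|x\|=\langle Bx,x\rangle^{1/2}$ on $\mathbb E$ and $\|s\|_*=\langle s,B^{-1}s\rangle^{1/2}$ on $\mathbb E^*$. Norms of symmetric multilinear forms are induced: $\|\nabla^pf(x)\|=\max\{\nabla^pf(x)[h_1,\dots,h_p]:\ \|h_i\|\le1\}$. Notation: $\nabla^2 f(x)[h]^2=\langle\nabla^2f(x)h,h\rangle$. Problem. $\min_{x\in\operatorname{dom}\psi}\{F(x)=f(x)+\psi(x)\}$, where $f:\mathbb E\to\mathbb R$ is convex and several times differentiable and $\psi:\mathbb E\to\mathbb R\cup\{+\infty\}$ is a proper closed convex function; $F_*$ is the optimal value. Smoothness constants. $L_{p,\nu}=\sup_{x\ne y}\|\nabla^pf(x)-\nabla^pf(y)\|/\|x-y\|^\nu$ for $p\in\{2,3\}$, $\nu\in[0,1]$ (equal to $+\infty$ if the supremum is infinite or $\nabla^pf$ does not exist). For $2\le q\le4$: $M_{2+\nu}=L_{2,\nu}$ for $\nu\in[0,1)$ and $M_{3+\nu}=L_{3,\nu}$ for $\nu\in[0,1]$. In particular $M_2=L_{2,0}$, $M_3=L_{3,0}$, $M_4=L_{3,1}$. In each of the three cases the corresponding constant $M_q$ is finite. Function $\mathcal H_\alpha$. For $t>0$, $\mathcal H_\alpha(t)=\inf_{2\le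 q\le4}(6M_q)^{\frac1{q-1}}\bigl(\tfrac1t\bigr)^{\alpha-\frac{q-2}{q-1}}$. Super-Universal Newton Method. Input: $x_0\in\operatorname{dom}\psi$, $\psi'(x_0)\in\partial\psi(x_0)$, arbitrary $\alpha\in[\frac23,1]$, $H_0>0$. For $k=0,1,\dots$: set $F'(x_k)=\nabla f(x_k)+\psi'(x_k)$ and $g_k=\|F'(x_k)\|_*$. For $j_k=0,1,2,\dots$ put $\lambda_k=4^{j_k}H_kg_k^\alpha$, $x_+=\operatorname{argmin}_x\{\langle\nabla f(x_k),x-x_k\rangle+\frac12\nabla^2f(x_k)[x-x_k]^2+\frac{\lambda_k}2\|x-x_k\|^2+\psi(x)\}$, $\psi'(x_+)=-\nabla f(x_k)-\nabla^2f(x_k)(x_+-x_k)-\lambda_kB(x_+-x_k)\in\partial\psi(x_+)$, $F'(x_+)=\nabla f(x_+)+\psi'(x_+)$, stopping at the first $j_k$ for which $\langle F'(x_+),x_k-x_+\rangle\ge\frac{1}{4\lambda_k}\|F'(x_+)\|_*^2$. Then set $x_{k+1}=x_+$ (with the corresponding $\psi'(x_{k+1})$) and $H_{k+1}=4^{j_k}H_k/4$. Here $g_0>0$; if $g_k=0$ for some $k$, then $x_k$ is a minimizer, the method stops, and one sets $x_i=x_k$, $g_i=0$ for $i>k$.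
   Formalization: In (1) and (2) the formal theorem also assumes ε ≤ F(x_k) − F_*, i.e. accuracy ε is not yet passed; without it a large ε (e.g. g_0 D) makes the condition on k void and both rates fail already at k = 1. Part (3) is as stated. *)

(* Defs.v *)
From HB Require Import structures.
From mathcomp Require Import all_boot all_order all_algebra.
From mathcomp Require Import all_classical all_reals all_analysis.
From mathcomp Require Import ring lra.

Set Implicit Arguments.
Unset Strict Implicit.
Unset Printing Implicit Defensive.

Import Order.TTheory GRing.Theory Num.Theory.
Import numFieldNormedType.Exports.

Local Open Scope classical_set_scope.
Local Open Scope ring_scope.

Notation dual_space E := 'Hom(E, GRing.regular _).

(* The operator B : E -> E^*, with <B x, y> written [B x y]. *)
Record spd_operator (R : realType) (E : vectType R) := SpdOperator {
  spd_op :> 'Hom(E, dual_space E) ;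
  spd_op_sym : forall x y : E, spd_op x y = spd_op y x ;
  spd_op_gt0 : forall x : E, x != 0 -> 0 < spd_op x x
}.

(* E carrying the topology and the norm <B x, x>^(1/2). *)
Definition euclidean (R : realType) (E : vectType R) (B : spd_operator E) : Type
  := E.

Section euclidean_norm.
Context (R : realType) (E : vectType R) (B : spd_operator E).

HB.instance Definition _ := Vector.copy (euclidean B) E.

Let norm (x : euclidean B) : R := Num.sqrt (B x x).

Let B_ge0 (x : E) : 0 <= B x x.
Proof.
by have [->|/(spd_op_gt0 B)/ltW//] := eqVneq x 0; rewrite linear0.
Qed.

Let BZ (a : R) (x : E) : B (a *: x) (a *: x) = a ^+ 2 * B x x.
Proof. by rewrite !linearZ /= scale_lfunE /= -[RHS]mulrA. Qed.

Let BD (x y : E) : B (x + y) (x + y) = B x x + 2 * B x y + B y y.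
Proof.
rewrite !linearD /= !add_lfunE (spd_op_sym B y x); ring.
Qed.

Let cauchy_schwarz (x y : E) : B x y ^+ 2 <= B x x * B y y.
Proof.
have [->|y0] := eqVneq y 0; first by rewrite !linear0 mulr0 expr0n.
have := B_ge0 (B y y *: x + - B x y *: y).
rewrite BD !BZ !linearZ /= scale_lfunE.
have -> : B y y ^+ 2 * B x x + 2 * (- B x y * (B y y * B x y)) +
    (- B x y) ^+ 2 * B y y = B y y * (B x x * B y y - B x y ^+ 2) by ring.
by rewrite pmulr_rge0 ?spd_op_gt0// subr_ge0.
Qed.

Let ler_normD (x y : euclidean B) : norm (x + y) <= norm x + norm y.
Proof.
rewrite -(ler_pXn2r (n := 2))// ?nnegrE ?addr_ge0 ?sqrtr_ge0//.
rewrite sqr_sqrtr// BD sqrrD !sqr_sqrtr// lerD2r lerD2l -sqrtrM//.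
suff : B x y <= Num.sqrt (B x x * B y y) by lra.
by rewrite (le_trans (ler_norm _))// -sqrtr_sqr ler_wsqrtr.
Qed.

Let normrZ (a : R) (x : euclidean B) : norm (a *: x) = `|a| * norm x.
Proof. by rewrite /norm BZ sqrtrM ?sqr_ge0// sqrtr_sqr. Qed.

Let normr0_eq0 (x : euclidean B) : norm x = 0 -> x = 0.
Proof.
apply: contra_eq => x0; rewrite gt_eqF// sqrtr_gt0.
exact: spd_op_gt0.
Qed.

HB.instance Definition _ := @Lmodule_isNormed.Build R (euclidean B) norm
  ler_normD normrZ normr0_eq0.

Lemma euclidean_normE (x : euclidean B) : `|x| = Num.sqrt (B x x).
Proof. by []. Qed.

End euclidean_norm.

Section problem.
Context (R : realType) (E : vectType R) (B : spd_operator E).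
Local Notation V := (euclidean B).
Implicit Types (f : V -> R) (psi : V -> \bar R) (x y : V) (s : dual_space V).

Definition riesz x : dual_space V := B x.

Definition dual_norm s : R := Num.sqrt (s ((spd_op B)^-1%VF s)).

(* iter_derive f [:: h_1; ...; h_p] x is the derivative of f at x along
   h_p, ..., h_1 in turn; when f is p times differentiable this is the
   symmetric p-linear form (D^p f)(x)[h_1, ..., h_p]. *)
Definition iter_derive f (hs : seq V) : V -> R :=
  foldr (fun h g => 'D_h g) f hs.

(* Existence of the p-th Frechet differential on the whole space. Since V is
   finite-dimensional, D^i f is Frechet differentiable as a map into i-linear
   forms iff it is so once evaluated at every (h_1, ..., h_i). *)
Definition times_differentiable (p : nat) f : Prop :=
  forall hs : seq V, (size hs < p)%N ->
  forall x, differentiable (iter_derive f hs) x.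

Definition gradient f x : dual_space V := linfun ('d f x).

(* The element (D^2 f)(x)h of the dual space; [linfun] turns a function known
   to be linear into an element of 'Hom. *)
Definition hessian f x (h : V) : dual_space V :=
  linfun (fun u : V => iter_derive f [:: h; u] x).

Definition form_norm (p : nat) (T : p.-tuple V -> R) : \bar R :=
  ereal_sup [set (T hs)%:E | hs in
    [set hs : p.-tuple V | forall i, `|tnth hs i| <= 1]].

(* L_{p, nu}. When V = 0 the supremum is over the empty set, hence -oo; every
   gradient then vanishes, which the hypothesis 0 < g_0 excludes. *)
Definition holder_constant f (p : nat) (nu : R) : \bar R :=
  if `[< times_differentiable p f >] then
    ereal_sup [set (form_norm (fun hs : p.-tuple V =>
                      (iter_derive f hs z.1 - iter_derive f hs z.2)%R)
                    * ((`|z.1 - z.2| `^ nu)^-1)%:E)%E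
              | z in [set z : V * V | z.1 != z.2]]
  else +oo%E.

(* M_q for 2 <= q <= 4; at q = 3 this is L_{3, 0} and not L_{2, 1}. *)
Definition smoothness f (q : R) : \bar R :=
  if q < 3 then holder_constant f 2 (q - 2) else holder_constant f 3 (q - 3).

Definition calH f (alpha t : R) : \bar R :=
  ereal_inf [set ((6%:E * smoothness f q) `^ (q - 1)^-1
                  * (t^-1 `^ (alpha - (q - 2) / (q - 1)))%:E)%E
            | q in [set q : R | 2 <= q <= 4]].

Definition edom psi : set V := [set x | (psi x < +oo)%E].

Definition epigraph psi : set (V * R^o)%type :=
  [set p | (psi p.1 <= p.2%:E)%E].

Definition proper_closed_convex psi : Prop :=
  [/\ forall x, psi x != -oo%E, edom psi !=set0,
      closed (epigraph psi) & convex_set (epigraph psi)].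

Definition subdifferential psi x : set (dual_space V) :=
  [set s | edom psi x /\ forall y, (psi x + (s (y - x))%:E <= psi y)%E].

Definition objective f psi x : \bar R := ((f x)%:E + psi x)%E.

Definition optimal_value f psi : \bar R :=
  ereal_inf [set objective f psi x | x in edom psi].

Definition sublevel f psi x0 : set V :=
  [set x | edom psi x /\ (objective f psi x <= objective f psi x0)%E].

Definition diameter (A : set V) : R :=
  sup [set `|z.1 - z.2| | z in A `*` A].

Definition newton_model f psi x (lambda : R) y : \bar R :=
  ((gradient f x (y - x) + 2^-1 * hessian f x (y - x) (y - x)
    + lambda / 2 * `|y - x| ^+ 2)%:E + psi y)%E.

Definition newton_step f psi x (lambda : R) : set V :=
  [set y | forall z, (newton_model f psi x lambda y
                      <= newton_model f psi x lambda z)%E].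

(* psi'(y), for y the step taken from x *)
Definition step_subgradient f x (lambda : R) y : dual_space V :=
  - gradient f x - hessian f x (y - x) - lambda *: riesz (y - x).

Definition accepts f x (lambda : R) y : Prop :=
  let F' := gradient f y + step_subgradient f x lambda y in
  (4 * lambda)^-1 * dual_norm F' ^+ 2 <= F' (x - y).

(* The sequences x_k, psi'(x_k), H_k are generated by the method with parameter
   alpha. The exponent j is the first one accepted; after a
   stationary point has been reached the sequences stay constant. *)
Record super_universal_newton f psi (alpha : R)
    (x : nat -> V) (dpsi : nat -> dual_space V) (H : nat -> R) : Prop := {
  sun_init : subdifferential psi (x 0%N) (dpsi 0%N) ;
  sun_H0 : 0 < H 0%N ;
  sun_stop : forall k, dual_norm (gradient f (x k) + dpsi k) = 0 ->
    x k.+1 = x k /\ dpsi k.+1 = dpsi k ;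
  sun_step : forall k, dual_norm (gradient f (x k) + dpsi k) != 0 ->
    let lambda i :=
      4 ^+ i * H k * dual_norm (gradient f (x k) + dpsi k) `^ alpha in
    exists j : nat,
    [/\ newton_step f psi (x k) (lambda j) (x k.+1),
        dpsi k.+1 = step_subgradient f (x k) (lambda j) (x k.+1),
        accepts f (x k) (lambda j) (x k.+1),
        forall i y, (i < j)%N -> newton_step f psi (x k) (lambda i) y ->
          ~ accepts f (x k) (lambda i) y
      & H k.+1 = 4 ^+ j * H k / 4]
}.

End problem.

(* Main.v *)
(* Write [u] for a step, [r = |u|], [g] for the norm of the current subgradient
   and [b = (q - 2) / (q - 1)]. Monotonicity of the subdifferential of [psi] gives
   [D^2 f(x)[u]^2 + lambda r^2 <= g r], hence [lambda r <= g]. A step is accepted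
   as soon as the Taylor residual of the gradient is at most [lambda r]: expand
   [|F'(x+) + lambda B u|^2]. For [q = 3, 4] the residual is controlled by
   convexity, which bounds the third derivative through [D^2 f(x + t v)[u]^2 >= 0]
   for all [t]; so every [lambda >= (6 M_q)^(1/(q-1)) g^b] is accepted. Since
   accepted steps satisfy [g+ <= 4 g], the line search keeps
   [lambda_k <= 4 (6 M_q)^(1/(q-1)) g_k^b], and each step decreases [F] by at least
   [g_{k+1}^2 / (4 lambda_k)].

   For [q = 3, 4], with [gap <= g D], this yields that the increments of
   [gap^(-1/(q-1))] are bounded below by products of powers of the ratios
   [g_{k+1} / g_k] and [gap_{k+1} / gap_k], whose logarithms telescope; the
   condition on [k] says that the sum of these logarithms is at least [- k / 2].
   For [q = 2] the recurrence [gap_{k+1}^2 <= K (gap_k - gap_{k+1})] suffices, the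
   first gap being bounded by comparing the quadratic model with [F]. *)
Require Import Defs.
From HB Require Import structures.
From mathcomp Require Import all_boot all_order all_algebra.
From mathcomp Require Import all_classical all_reals all_analysis.
From mathcomp Require Import ring lra.

Set Implicit Arguments.
Unset Strict Implicit.
Unset Printing Implicit Defensive.

Import Order.TTheory GRing.Theory Num.Theory.
Import numFieldNormedType.Exports.

Local Open Scope classical_set_scope.
Local Open Scope ring_scope.

(** * Geometry of the Euclidean space and its dual *)

Section euclidean_geometry.
Context (R : realType) (E : vectType R) (B : spd_operator E).
Local Notation V := (euclidean B).
Implicit Types (x y : V) (s : dual_space V).

Lemma spd_op_ge0 x : 0 <= B x x.
Proof.
by have [->|/(spd_op_gt0 B)/ltW//] := eqVneq (x : E) 0; rewrite linear0.
Qed.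

Lemma euclidean_norm_sqr x : `|x| ^+ 2 = B x x.
Proof. by rewrite euclidean_normE sqr_sqrtr// spd_op_ge0. Qed.

Lemma spd_opD x y : B (x + y) (x + y) = B x x + 2 * B x y + B y y :> R.
Proof.
rewrite !linearD /= !add_lfunE (spd_op_sym B y x); ring.
Qed.

Lemma spd_opZl (a : R) x y : B (a *: x) y = a * B x y :> R.
Proof. by rewrite linearZ /= scale_lfunE. Qed.

Lemma spd_opZr (a : R) x y : B x (a *: y) = a * B x y :> R.
Proof. by rewrite linearZ. Qed.

Lemma spd_op_le x y : B x y <= `|x| * `|y|.
Proof.
have [->|y0] := eqVneq y 0; first by rewrite linear0 mulr_ge0.
have [->|x0] := eqVneq x 0; first by rewrite linear0 lfunE mulr_ge0.
have := spd_op_ge0 (`|y| *: x + - `|x| *: y).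
rewrite spd_opD !(spd_opZl, spd_opZr) -!euclidean_norm_sqr.
rewrite (_ : _ + _ + _ =
  2 * (`|x| * `|y|) * (`|x| * `|y| - B x y)); last by ring.
by rewrite pmulr_rge0 ?subr_ge0// !mulr_gt0// normr_gt0.
Qed.

Lemma lker_spd_op : lker (spd_op B) == 0%VS.
Proof.
apply/lker0P => u v uv; apply/eqP; rewrite -subr_eq0; apply/negPn/negP => n0.
have Buv : B (u - v) = 0 by rewrite linearB /= uv subrr.
by have := spd_op_gt0 B n0; rewrite Buv lfunE ltxx.
Qed.

(** An injective linear map between spaces of equal finite dimension is onto. Every functional thus
    has a Riesz representative, which turns claims about [dual_norm] into claims about the norm of a
    vector. *)
Lemma spd_op_surj s : exists x, s = B x.
Proof.
have /eqP : (limg (spd_op B) == fullv)%VS.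
  rewrite eqEdim subvf /=.
  have := limg_dim_eq (f := spd_op B) (U := fullv).
  rewrite (eqP lker_spd_op) capv0 => /(_ erefl) ->.
  by rewrite !dimvf /= /dim /= muln1.
move=> im; have : s \in limg (spd_op B) by rewrite im memvf.
by move=> /memv_imgP[x _ ->]; exists x.
Qed.

Lemma dual_norm_riesz x : dual_norm (B x : dual_space V) = `|x|.
Proof.
by rewrite /dual_norm (lker0_lfunK lker_spd_op) euclidean_normE.
Qed.

Lemma dual_norm_ge0 s : 0 <= dual_norm s.
Proof. exact: sqrtr_ge0. Qed.

Lemma dual_norm_le s x : s x <= dual_norm s * `|x|.
Proof.
by have [y ->] := spd_op_surj s; rewrite dual_norm_riesz spd_op_le.
Qed.

Lemma ler_dual_norm s x : `|s x| <= dual_norm s * `|x|.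
Proof.
rewrite ler_norml dual_norm_le andbT lerNl.
by rewrite -[- _](linearN s) /= (le_trans (dual_norm_le _ _))// normrN.
Qed.

Lemma dual_norm_ub s (M : R) : 0 <= M -> (forall x, s x <= M * `|x|) ->
  dual_norm s <= M.
Proof.
have [y ->] := spd_op_surj s; rewrite dual_norm_riesz => M0.
have [->|y0] := eqVneq y 0; first by rewrite normr0.
by move=> /(_ y); rewrite -euclidean_norm_sqr expr2 ler_pM2r ?normr_gt0.
Qed.

Lemma dual_norm_add_riesz s x (a : R) :
  dual_norm (s + a *: riesz x) ^+ 2 =
  dual_norm s ^+ 2 + 2 * a * s x + a ^+ 2 * `|x| ^+ 2.
Proof.
have [y ->] := spd_op_surj s.
rewrite /riesz -[in LHS]linearZ -linearD !dual_norm_riesz !euclidean_norm_sqr.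
rewrite spd_opD !(spd_opZl, spd_opZr); ring.
Qed.

Lemma dual_continuous s : continuous (s : V -> R^o).
Proof.
move=> x; apply/(@cvgrPdist_le _ R^o V (nbhs x) (nbhs_filter x) s (s x)) => e e0.
near=> y.
rewrite -linearB (le_trans (ler_dual_norm _ _))//.
rewrite (@le_trans _ _ ((dual_norm s + 1) * `|x - y|))//.
  by rewrite ler_wpM2r// lerDl.
rewrite mulrC -ler_pdivlMr ?ltr_wpDl ?dual_norm_ge0//.
near: y; apply: (@cvgr_dist_le _ V _ _ _ id) => //.
by rewrite divr_gt0// ltr_wpDl ?dual_norm_ge0.
Unshelve. all: by end_near. Qed.

(** The ball is a closed subset of the continuous image of a box of coordinate vectors: each
    coordinate is a functional with a finite dual norm, hence bounded on the ball. *)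
Lemma compact_ball x (r : R) : compact [set y : V | `|y - x| <= r].
Proof.
pose e := vbasis (fullv : {vspace E}).
pose g (v : 'rV[R]_(\dim (fullv : {vspace E}))) : V := \sum_i v ord0 i *: e`_i.
have cg : continuous g.
  apply: continuous_big => [|i _ v].
    exact: (@pseudometric_normed_Zmodule.add_continuous _ V).
  apply: (@cvgZr_tmp _ V); first exact: (nbhs_filter v).
  exact: (@coord_continuous _ _ _ ord0 i v).
pose c i : dual_space V := linfun (coord e i : {linear _ -> R^o}).
have cE i y : c i y = coord e i y by rewrite lfunE.
pose A := [set v : 'rV[R]_(\dim (fullv : {vspace E})) |
   forall i, v ord0 i \in
     `[(- (dual_norm (c i) * (r + `|x|))), (dual_norm (c i) * (r + `|x|))]].
have cA : compact A.
  apply: (@rV_compact _ _ (fun i =>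
    `[(- (dual_norm (c i) * (r + `|x|))), (dual_norm (c i) * (r + `|x|))]%classic)).
  by move=> i; exact: segment_compact.
have cgA : compact (g @` A).
  by apply: continuous_compact => //; exact: continuous_subspaceT.
apply: (subclosed_compact _ cgA).
  rewrite [X in closed X](_ : _ = (fun y : V => `|y - x|) @^-1` [set z | z <= r])//.
  apply: closed_comp; last exact: closed_le.
  move=> y _; apply: (@cvg_norm _ V V (nbhs y) (nbhs_filter y) (fun z => z - x)).
  apply: (@cvgB _ V V (nbhs y) (nbhs_filter y) id (cst x)).
    exact: cvg_id.
  exact: (@cvg_cst V x V (nbhs y) (nbhs_filter y)).
move=> y /= yr; exists (\row_i coord e i y).
  move=> i; rewrite mxE -cE in_itv /= -ler_norml.
  rewrite (le_trans (ler_dual_norm _ _))// ler_wpM2l ?dual_norm_ge0//.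
  by rewrite -(subrK x y) (le_trans (ler_normD _ _))// lerD2r.
rewrite /g [RHS](coord_vbasis (memvf (y : E))).
by apply: eq_bigr => i _; rewrite mxE.
Qed.

End euclidean_geometry.

(** * Directional derivatives *)

Section directional_calculus.
Context (R : realType) (V : normedModType R).
Implicit Types (g : V -> R) (x u v w : V).

Lemma is_derive_line g x u (t : R) : differentiable g (x + t *: u) ->
  is_derive t 1 (fun s : R => g (x + s *: u)) ('D_u g (x + t *: u)).
Proof.
move=> dg.
have dl : is_diff t (fun s : R => x + s *: u) (fun s : R => s *: u).
  have H : is_diff t (cst x + (fun s : R => s *: u)) (0 + (fun s : R => s *: u)).
    exact: is_diffD.
  by apply: is_diff_eq; apply/funext => s /=; rewrite add0r.
have dlt : differentiable (fun s : R => x + s *: u) t by exact: ex_diff.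
have dgl : differentiable (g \o (fun s : R => x + s *: u)) t.
  exact: differentiable_comp dlt dg.
apply: DeriveDef; first exact: diff_derivable.
rewrite deriveE // (diff_comp dlt dg).
by rewrite /= diff_val scale1r -deriveE.
Qed.

Lemma mvt_line g x u : (forall y, differentiable g y) ->
  exists2 t : R, 0 < t < 1 & g (x + u) - g x = 'D_u g (x + t *: u).
Proof.
move=> dg.
have dl (s : R) : is_derive s 1 (fun s : R => g (x + s *: u)) ('D_u g (x + s *: u)).
  exact: is_derive_line.
have [|t tI] := @MVT R (fun s : R => g (x + s *: u))
  (fun s : R => 'D_u g (x + s *: u)) 0 1 ltr01 (fun s _ => dl s).
  apply: continuous_subspaceT => s.
  apply: differentiable_continuous; apply/derivable1_diffP.
  by have [] := dl s.
rewrite scale1r scale0r addr0 subr0 mulr1 => ->.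
by exists t => //; move: tI; rewrite in_itv.
Qed.

Lemma differentiable_approx g x : differentiable g x ->
  forall e, 0 < e -> exists2 d, 0 < d &
    forall w, `|w| < d -> `|g (x + w) - g x - 'd g x w| <= e * `|w|.
Proof.
move=> /diff_locallyxC dg e e0.
have /nbhs_normP[d d0 dP] : \forall w \near (0 : V),
    `|g (x + w) - g x - 'd g x w| <= e * `|w|.
  near=> w; rewrite dg.
  have K (a b c : R) : a + b + c - a - b = c by ring.
  rewrite K; near: w; exact: littleoP.
exists d => // w wd; apply: dP; rewrite /ball_ /= sub0r normrN //.
Unshelve. all: by end_near. Qed.

Lemma deriveZv g x u (a : R) : differentiable g x ->
  'D_(a *: u) g x = a * 'D_u g x.
Proof. by move=> dg; rewrite !deriveE// linearZ. Qed.

Lemma deriveDv g x u v : differentiable g x ->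
  'D_(u + v) g x = 'D_u g x + 'D_v g x.
Proof. by move=> dg; rewrite !deriveE// linearD. Qed.

(** The mean value theorem along [u], applied to the increment [h y = g (y + t *: v) - g y], leaves
    [t] times a difference of two values of ['D_u g] near [x]; differentiability of ['D_u g] at [x]
    estimates that difference. *)
Lemma second_difference g x u v : (forall y, differentiable g y) ->
  differentiable ('D_u g) x ->
  forall e, 0 < e -> exists2 d, 0 < d & forall t, 0 < t < d ->
    `|g (x + t *: u + t *: v) - g (x + t *: u) - g (x + t *: v) + g x
      - t ^+ 2 * 'D_v ('D_u g) x| <= e * t ^+ 2.
Proof.
move=> dg dug e e0.
(* [K] dominates [(|w1| + |w2|) / t] for the displacements [w1], [w2] below; the 1 keeps it
   positive. *)
pose K := 2 * `|u| + `|v| + 1.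
have K0 : 0 < K by rewrite ltr_wpDl// addr_ge0// mulr_ge0.
have [d d0 dP] := differentiable_approx dug (divr_gt0 e0 K0).
exists (d / K); first exact: divr_gt0.
move=> t /andP[t0]; rewrite ltr_pdivlMr// => tK.
pose h y : R := g (y + t *: v) - g y.
have dgs y : differentiable (fun y => g (y + t *: v)) y.
  have ds : differentiable (fun y => y + t *: v) y.
    exact: (@differentiableD _ _ _ id (cst (t *: v))).
  exact: (differentiable_comp ds (dg _)).
have dh y : differentiable h y by exact: differentiableB.
have [s /andP[s0 s1] hs] := mvt_line x (t *: u) dh.
have -> : g (x + t *: u + t *: v) - g (x + t *: u) - g (x + t *: v) + g x =
    h (x + t *: u) - h x by rewrite /h; ring.
have shift y w : 'D_w (fun y => g (y + t *: v)) y = 'D_w g (y + t *: v).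
  rewrite /derive (_ : (fun h : R => _) =
    (fun h => h^-1 *: ((g \o shift (y + t *: v)) (h *: w) - g (y + t *: v))))//.
  by apply/funext => a /=; rewrite addrA.
rewrite hs deriveZv// deriveB; [|exact: diff_derivable|exact: diff_derivable].
rewrite shift.
set w2 := s *: (t *: u); set w1 := w2 + t *: v.
have w2t : `|w2| <= t * `|u|.
  rewrite /w2 scalerA normrZ ler_wpM2r// gtr0_norm ?mulr_gt0//.
  by rewrite ger_pMl// ltW.
have w1t : `|w1| <= t * (`|u| + `|v|).
  by rewrite (le_trans (ler_normD _ _))// mulrDr lerD// normrZ gtr0_norm.
have w1d : `|w1| < d.
  rewrite (le_lt_trans w1t)// (le_lt_trans _ tK)// ler_pM2l// /K.
  have := normr_ge0 u; lra.
have w2d : `|w2| < d.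
  rewrite (le_lt_trans w2t)// (le_lt_trans _ tK)// ler_pM2l// /K.
  by have := normr_ge0 u; have := normr_ge0 v; lra.
rewrite -addrA -/w1.
have := dP _ w1d; have := dP _ w2d.
rewrite (deriveE v dug).
have -> : 'd ('D_u g) x w1 = 'd ('D_u g) x w2 + t * 'd ('D_u g) x v.
  by rewrite linearD; congr (_ + _); rewrite linearZ.
set A := 'D_u g (x + w1); set A2 := 'D_u g (x + w2); set A0 := 'D_u g x.
set D1 := 'd _ x w2; set D2 := 'd _ x v => H2 H1.
have -> : t * (A - A2) - t ^+ 2 * D2 =
  t * ((A - A0 - (D1 + t * D2)) - (A2 - A0 - D1)) by ring.
rewrite normrM gtr0_norm// expr2 [leRHS]mulrCA ler_pM2l//.
rewrite (le_trans (ler_normB _ _))// (le_trans (lerD H1 H2))//.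
rewrite -mulrDr -mulrA ler_pM2l// ler_pdivrMl//.
rewrite /K; nra.
Qed.

(** The second difference is symmetric in [u] and [v], so both iterated derivatives are its limit
    after division by [t ^+ 2]. Were they [n] apart, two errors of [n / 4] could not bridge the
    distance. *)
Lemma derive_swap g x u v : (forall y, differentiable g y) ->
  differentiable ('D_u g) x -> differentiable ('D_v g) x ->
  'D_v ('D_u g) x = 'D_u ('D_v g) x.
Proof.
move=> dg du dv; apply/eqP; rewrite -subr_eq0 -normr_eq0.
apply/negPn/negP => n0.
set n := `|_| in n0.
have ngt0 : 0 < n by rewrite lt_def n0 /n normr_ge0.
have e0 : 0 < n / 4 by rewrite divr_gt0.
have [d1 d10 H1] := second_difference v dg du e0.
have [d2 d20 H2] := second_difference u dg dv e0.
have m0 : 0 < Num.min d1 d2 by rewrite lt_min d10.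
pose t := Num.min d1 d2 / 2.
have t0 : 0 < t by rewrite divr_gt0.
have tm : t < Num.min d1 d2 by rewrite ltr_pdivrMr// ltr_pMr// ltr1n.
move: tm; rewrite lt_min => /andP[t1 t2].
have := H1 t; rewrite t0 t1 => /(_ isT) {}H1.
have := H2 t; rewrite t0 t2 => /(_ isT) {}H2.
have : t ^+ 2 * n <= n / 2 * t ^+ 2.
  rewrite /n -{1}(ger0_norm (sqr_ge0 t)) -normrM.
  rewrite (_ : n / 2 * t ^+ 2 = n / 4 * t ^+ 2 + n / 4 * t ^+ 2); last by field.
  apply: le_trans (lerD H2 H1); apply: le_trans (ler_normB _ _).
  rewrite (addrAC x (t *: v)) le_eqVlt; apply/orP; left; apply/eqP.
  move: ('D_v ('D_u g) x) ('D_u ('D_v g) x) (g _) (g _) (g _) => a b c1 c2 c3.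
  by congr (`|_|); ring.
rewrite mulrC ler_pM2r ?exprn_gt0// leNgt ltr_pdivrMr// ltr_pMr//.
by rewrite ltr1n.
Qed.

(** Taking [v = - u] collapses the second difference to [2 * g x - g (x + t *: u) - g (x - t *: u)],
    which is nonpositive and behaves like [- t ^+ 2] times the second derivative. *)
Lemma derive2_ge0 g x u : (forall y, differentiable g y) ->
  differentiable ('D_u g) x ->
  (forall t : R, 2 * g x <= g (x + t *: u) + g (x - t *: u)) ->
  0 <= 'D_u ('D_u g) x.
Proof.
move=> dg du H; rewrite leNgt; apply/negP => n0.
have dN : 'D_(- u) ('D_u g) x = - 'D_u ('D_u g) x.
  by rewrite -scaleN1r deriveZv// mulN1r.
have e0 : 0 < - 'D_u ('D_u g) x / 2 by rewrite divr_gt0// oppr_gt0.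
have [d d0 dP] := second_difference (- u) dg du e0.
have := dP (d / 2); rewrite divr_gt0//= ltr_pdivrMr// ltr_pMr// ltr1n => /(_ isT).
rewrite scalerN addrK dN ler_norml => /andP[+ _].
have : (d / 2) ^+ 2 * 'D_u ('D_u g) x < 0.
  by rewrite pmulr_rlt0// exprn_gt0// divr_gt0.
move: (H (d / 2)).
move: ('D_u ('D_u g) x) (g _) (g _) (g _) ((d / 2) ^+ 2) => D a b c s.
clear; lra.
Qed.

End directional_calculus.

(** * Hessians of convex functions and Hölder constants *)

Section smooth_convex.
Context (R : realType) (E : vectType R) (B : spd_operator E).
Local Notation V := (euclidean B).
Implicit Types (f : V -> R) (x y u v w : V).

Lemma gradientE f x u : differentiable f x -> gradient f x u = 'D_u f x.
Proof. by move=> df; rewrite /gradient lfunE deriveE. Qed.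

Section twice.
Variables (f : V -> R) (df : times_differentiable 2 f).

Lemma td_diff1 x : differentiable f x.
Proof. exact: (df (hs := [::])). Qed.

Lemma td_diff2 u x : differentiable ('D_u f) x.
Proof. exact: (df (hs := [:: u])). Qed.

(** [linfun] can be evaluated once its argument is known to be linear in [u]. Swapping the two
    derivatives shows this, since the argument becomes the differential of ['D_h f]. *)
Lemma hessianE x h u : hessian f x h u = 'D_h ('D_u f) x.
Proof.
have -> : hessian f x h = linfun ('d ('D_h f) x).
  congr linfun; apply/funext => w /=.
  rewrite (derive_swap td_diff1 (td_diff2 w x) (td_diff2 h x)).
  by rewrite deriveE//; exact: td_diff2.
rewrite lfunE /= -deriveE; last exact: td_diff2.
by rewrite (derive_swap td_diff1 (td_diff2 u x) (td_diff2 h x)).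
Qed.

Lemma hessian_sym x h u : hessian f x h u = hessian f x u h.
Proof.
apply: etrans (hessianE x h u) (etrans _ (esym (hessianE x u h))).
exact: (derive_swap td_diff1 (td_diff2 u x) (td_diff2 h x)).
Qed.

Hypothesis cf : convex_function setT f.

Lemma hessian_ge0 x u : 0 <= 'D_u ('D_u f) x.
Proof.
apply: derive2_ge0 => [|| t]; [exact: td_diff1|exact: td_diff2|].
have h0 : 0 <= 2^-1 :> R by [].
have h1 : 2^-1 <= 1 :> R by rewrite invf_le1// ler1n.
have : f (2^-1 *: (x + t *: u) + (1 - 2^-1) *: (x - t *: u)) <=
    2^-1 * f (x + t *: u) + (1 - 2^-1) * f (x - t *: u).
  exact: (@cf (Itv01 h0 h1) (x + t *: u) (x - t *: u) (mem_set I) (mem_set I)).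
have -> : 1 - 2^-1 = 2^-1 :> R by field.
have -> : 2^-1 *: (x + t *: u) + 2^-1 *: (x - t *: u) = x.
  rewrite -scalerDr addrACA subrr addr0 -mulr2n -(scaler_nat 2 x) scalerA.
  by rewrite mulVf// scale1r.
by clear; lra.
Qed.

(** Two applications of the mean value theorem express the difference of the two sides as a positive
    multiple of a second derivative. *)
Lemma convex_gradient_le x y : f x + gradient f x (y - x) <= f y.
Proof.
have [t /andP[t0 _]] := mvt_line x (y - x) td_diff1.
rewrite (addrC x) subrK gradientE; last exact: td_diff1.
have [s _] := mvt_line x (t *: (y - x)) (td_diff2 (y - x)).
rewrite deriveZv; last exact: td_diff2.
have := hessian_ge0 (x + s *: (t *: (y - x))) (y - x).
move: ('D_(y - x) ('D_(y - x) f) _) ('D_(y - x) f _) ('D_(y - x) f _) => a b c.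
move=> a0 bc fyx; have : 0 <= t * a by rewrite mulr_ge0// ltW.
lra.
Qed.

End twice.

Lemma iter_derive_scale p f (a : V -> R) (b : V -> V) (hs : seq V) :
  times_differentiable p f -> (size hs <= p)%N ->
  iter_derive f [seq a h *: b h | h <- hs] =
  (fun x => \prod_(h <- hs) a h * iter_derive f [seq b h | h <- hs] x).
Proof.
move=> df; elim: hs => [|h hs IH] hsp.
  by apply/funext => x; rewrite big_nil mul1r.
have db y : differentiable (iter_derive f [seq b h | h <- hs]) y.
  by apply: df; rewrite size_map.
apply/funext => x; rewrite /= IH; last exact: ltnW.
rewrite deriveZv; last exact: differentiableZ.
rewrite (deriveZ (\prod_(h <- hs) a h)); last exact: diff_derivable.
by rewrite big_cons /GRing.scale /= mulrA.
Qed.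

Lemma ereal_sup_imageP (T : Type) (A : set T) (F : T -> \bar R) t :
  A t -> (F t <= ereal_sup [set F t | t in A])%E.
Proof. by move=> At; apply: ereal_sup_ubound; exists t. Qed.

(** By homogeneity in each direction it suffices to treat directions in the unit ball, over which
    [form_norm] is a supremum. *)
Lemma holder_constant_le p (nu : R) f (M : R) (hs : p.-tuple V) x y :
  holder_constant f p nu = M%:E -> x != y ->
  iter_derive f hs x - iter_derive f hs y <=
    M * `|x - y| `^ nu * \prod_(h <- hs) `|h|.
Proof.
rewrite /holder_constant; case: asboolP => // df Mdef xy.
(* The inverse of 0 being 0, [b 0 = 0]; so [b h] lies in the unit ball for every [h]. *)
pose b (h : V) := `|h|^-1 *: h.
have hsE : hs = [seq `|h| *: b h | h <- hs] :> seq V.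
  rewrite -[LHS]map_id; apply: eq_map => h; rewrite /b scalerA.
  have [->|h0] := eqVneq h 0; first by rewrite scaler0.
  by rewrite divff ?normr_eq0// scale1r.
rewrite {1 2}hsE (iter_derive_scale _ _ df) ?size_tuple// -mulrBr mulrC.
rewrite ler_wpM2r ?prodr_ge0//.
have n0 : 0 < `|x - y| `^ nu by rewrite powR_gt0// normr_gt0 subr_eq0.
rewrite -ler_pdivrMr// -lee_fin -Mdef.
pose Z (z : V * V) := (form_norm (fun hs : p.-tuple V =>
  (iter_derive f hs z.1 - iter_derive f hs z.2)%R) *
  ((`|z.1 - z.2| `^ nu)^-1)%:E)%E.
apply: le_trans (@ereal_sup_imageP _ [set z | z.1 != z.2] Z (x, y) xy).
rewrite /Z /= EFinM lee_wpmul2r//.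
pose bt := map_tuple b hs.
rewrite /form_norm; apply: (@ereal_sup_imageP _ _ (fun hs : p.-tuple V =>
  (iter_derive f hs x - iter_derive f hs y)%:E) bt) => i.
rewrite tnth_map /b normrZ normfV normr_id.
have [->|h0] := eqVneq (tnth hs i) 0; first by rewrite normr0 mulr0.
by rewrite mulVf// normr_eq0.
Qed.

(** A nonzero vector supplies an admissible pair of points, and the form vanishes on the zero tuple.
    This excludes the value [-oo]. *)
Lemma holder_constant_ge0 p (nu : R) f x :
  x != 0 -> (0 <= holder_constant f p.+1 nu)%E.
Proof.
move=> x0; rewrite /holder_constant; case: asboolP => // df.
pose Z (z : V * V) := (form_norm (fun hs : p.+1.-tuple V =>
  (iter_derive f hs z.1 - iter_derive f hs z.2)%R) *
  ((`|z.1 - z.2| `^ nu)^-1)%:E)%E.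
apply: le_trans (@ereal_sup_imageP _ [set z | z.1 != z.2] Z (x, 0) x0).
rewrite /Z /= mule_ge0// ?lee_fin ?invr_ge0 ?powR_ge0//.
apply: le_trans (@ereal_sup_imageP _ _ (fun hs : p.+1.-tuple V =>
  (iter_derive f hs x - iter_derive f hs 0)%:E) (nseq_tuple p.+1 0) _).
  by rewrite lee_fin /= !derive0 subrr.
by move=> i; rewrite tnth_nseq normr0.
Qed.

Lemma holder_constant_differentiable p (nu : R) f :
  (holder_constant f p nu < +oo)%E -> times_differentiable p f.
Proof. by rewrite /holder_constant; case: asboolP. Qed.

End smooth_convex.

(** * Taylor residual of the gradient *)

Section taylor_residual.
Context (R : realType) (E : vectType R) (B : spd_operator E).
Local Notation V := (euclidean B).
Variable f : V -> R.
Hypotheses (df : times_differentiable 2 f) (cf : convex_function setT f).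
Implicit Types (x u v : V).

Definition taylor_residual x u : dual_space V :=
  gradient f (x + u) - gradient f x - hessian f x u.

Lemma taylor_residualE x u v : taylor_residual x u v =
  'D_v f (x + u) - 'D_v f x - 'D_u ('D_v f) x.
Proof.
have -> : taylor_residual x u v =
    gradient f (x + u) v - gradient f x v - hessian f x u v.
  by rewrite /taylor_residual !add_lfunE !opp_lfunE.
by rewrite hessianE// !gradientE//; exact: td_diff1.
Qed.

Lemma taylor_residual_mvt x u v : exists2 t : R, 0 < t < 1 &
  taylor_residual x u v = 'D_u ('D_v f) (x + t *: u) - 'D_u ('D_v f) x.
Proof.
have [t t01 Et] := mvt_line x u (td_diff2 df v).
by exists t => //; rewrite taylor_residualE Et.
Qed.

Lemma taylor_residual2_le (M : R) x u : 0 <= M ->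
  holder_constant f 2 0 = M%:E -> dual_norm (taylor_residual x u) <= M * `|u|.
Proof.
move=> M0 Mf; apply: dual_norm_ub => [|v]; first exact: mulr_ge0.
have [t _ ->] := taylor_residual_mvt x u v.
have [->|ne] := eqVneq (x + t *: u) x; first by rewrite subrr !mulr_ge0.
have := @holder_constant_le _ _ _ _ _ _ _ [tuple u; v] _ _ Mf ne.
by rewrite powRr0 mulr1 !big_cons big_nil mulr1 mulrA.
Qed.

Lemma taylor2_le (M : R) x u : 0 <= M -> holder_constant f 2 0 = M%:E ->
  `|f (x + u) - f x - 'D_u f x - 2^-1 * 'D_u ('D_u f) x| <= M * `|u| ^+ 2.
Proof.
move=> M0 Mf.
set a := 'D_u f x; set b := 'D_u ('D_u f) x.
(* [q] is [f] on the segment minus its quadratic Taylor polynomial without the constant term. One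
   mean value step bounds its increment by [q' t], and a second one writes [q' t] as [t] times a
   variation of the Hessian form. *)
pose q (s : R) : R := f (x + s *: u) - (s * a + s ^+ 2 * (2^-1 * b)).
have dq (s : R) : is_derive s 1 q ('D_u f (x + s *: u) - (a + s * b)).
  have := is_derive_line (td_diff1 df (x + s *: u)) => df'.
  have dp : is_derive s 1 ((a \*: (@id R)) + ((2^-1 * b) \*: ((@id R) ^+ 2)))
      (a *: 1 + (2^-1 * b) *: ((2%:R * s ^+ 1) *: 1)).
    exact: is_deriveD.
  have -> : 'D_u f (x + s *: u) - (a + s * b) = 'D_u f (x + s *: u) -
      (a *: 1 + (2^-1 * b) *: ((2%:R * s ^+ 1) *: 1)).
    by rewrite /GRing.scale /=; field.
  have -> : q = (fun s => f (x + s *: u)) -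
      ((a \*: (@id R)) + ((2^-1 * b) \*: ((@id R) ^+ 2))).
    apply/funext => r; rewrite /q /= fctE /=; congr (_ - _).
    by rewrite -[RHS]/(a * r + (2^-1 * b) * ((id ^+ 2) r)) fctE /=; ring.
  exact: (is_deriveB df' dp).
have [|t] := @MVT R q (fun s => 'D_u f (x + s *: u) - (a + s * b)) 0 1 ltr01
    (fun s _ => dq s).
  apply: continuous_subspaceT => s.
  by apply: differentiable_continuous; apply/derivable1_diffP; have [] := dq s.
rewrite in_itv => /andP[t0 t1].
rewrite /q scale1r scale0r addr0 subr0 mulr1 expr1n !mul1r mul0r expr0n /=.
rewrite mul0r addr0 subr0 => qE.
have -> : f (x + u) - f x - a - 2^-1 * b = 'D_u f (x + t *: u) - a - t * b.
  move: qE; clear q dq.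
  move: (f _) (f _) ('D_u f _) a (t * b) (2^-1 * b) => c1 c2 c3 c4 c5 c6.
  clear; lra.
have [s _ sE] := mvt_line x (t *: u) (td_diff2 df u).
rewrite /a sE deriveZv; last exact: td_diff2.
rewrite -mulrBr normrM gtr0_norm//.
set y := x + _.
suff : `|'D_u ('D_u f) y - b| <= M * `|u| ^+ 2.
  move=> H; apply: le_trans (ler_wpM2l (ltW t0) H) _.
  exact: ler_piMl (mulr_ge0 M0 (sqr_ge0 _)) (ltW t1).
have [->|ne] := eqVneq y x; first by rewrite subrr normr0 !mulr_ge0.
have := @holder_constant_le _ _ _ _ _ _ _ [tuple u; u] _ _ Mf ne.
rewrite eq_sym in ne.
have := @holder_constant_le _ _ _ _ _ _ _ [tuple u; u] _ _ Mf ne.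
rewrite !powRr0 !mulr1 !big_cons !big_nil !mulr1 -!expr2 /= ler_norml.
move=> H1 H2; apply/andP; split; last exact: H2.
by rewrite lerNl opprB; exact: H1.
Qed.

(** Here [a] and [a'] are values of a function at distance [t], [b'] its slope in between, [b] the
    slope at the start and [c] a bound on the variation of the slope. Both signs of [t] matter. *)
Lemma affine_minorant_ge0 (t a a' b b' c : R) :
  a' - a = t * b' -> 0 <= a' -> b' - b <= c -> b - b' <= c ->
  0 <= a + t * b + `|t| * c.
Proof.
move=> aa' a'0 b'b bb'; have [t0|t0] := leP 0 t.
  rewrite ger0_norm//.
  have : t * (b' - b) <= t * c by rewrite ler_wpM2l.
  lra.
rewrite ltr0_norm//.
have : - t * (b - b') <= - t * c by rewrite ler_wpM2l// oppr_ge0 ltW.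
lra.
Qed.

Section third.
Variables (M nu : R).
Hypotheses (nu0 : 0 <= nu) (M0 : 0 <= M) (Mf : holder_constant f 3 nu = M%:E).

Let df3 : times_differentiable 3 f.
Proof. by apply: (@holder_constant_differentiable _ _ _ _ nu); rewrite Mf ltry. Qed.

Lemma td_diff3 u v x : differentiable ('D_u ('D_v f)) x.
Proof. exact: (df3 (hs := [:: u; v])). Qed.

Lemma derive3_swap u v x :
  'D_u ('D_u ('D_v f)) x = 'D_v ('D_u ('D_u f)) x.
Proof.
have E2 : 'D_u ('D_v f) = 'D_v ('D_u f).
  apply/funext => y.
  exact: (derive_swap (td_diff1 df) (td_diff2 df v y) (td_diff2 df u y)).
apply: etrans (congr1 (fun g : V -> R => 'D_u g x) E2) _.
exact: (derive_swap (td_diff2 df u) (td_diff3 v u x) (td_diff3 u u x)).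
Qed.

Lemma derive3_le u v w x y : 'D_u ('D_v ('D_w f)) x - 'D_u ('D_v ('D_w f)) y <=
  M * `|x - y| `^ nu * (`|u| * `|v| * `|w|).
Proof.
have [->|ne] := eqVneq x y; first by rewrite !subrr !mulr_ge0// powR_ge0.
have := @holder_constant_le _ _ _ _ _ _ _ [tuple u; v; w] _ _ Mf ne.
by rewrite !big_cons big_nil mulr1 !mulrA.
Qed.

(** Convexity at [x + t *: v] makes the second derivative along [u] nonnegative there. Expanding it
    to first order from [x] costs the Hölder error of the third derivative; letting [t] vary later
    bounds that derivative itself. *)
Lemma hessian_line_ge0 x u v (t : R) :
  0 <= 'D_u ('D_u f) x + t * 'D_v ('D_u ('D_u f)) x +
       `|t| * (M * (`|t| * `|v|) `^ nu * (`|v| * `|u| ^+ 2)).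
Proof.
have [s /andP[s0 s1]] := mvt_line x (t *: v) (td_diff3 u u).
rewrite deriveZv; last exact: td_diff3.
set y := x + s *: (t *: v) => sE.
have yx : `|y - x| `^ nu <= (`|t| * `|v|) `^ nu.
  rewrite ge0_ler_powR ?nnegrE ?mulr_ge0//.
  rewrite /y addrAC subrr add0r scalerA normrZ ler_wpM2r// normrM.
  by rewrite ler_piMl// gtr0_norm// ltW.
have xy : `|x - y| `^ nu <= (`|t| * `|v|) `^ nu by rewrite distrC.
have le_c (r : R) : r <= (`|t| * `|v|) `^ nu ->
    M * r * (`|v| * `|u| * `|u|) <=
    M * (`|t| * `|v|) `^ nu * (`|v| * `|u| ^+ 2).
  move=> rle; rewrite -(mulrA `|v|) -expr2.
  by rewrite ler_wpM2r ?mulr_ge0 ?sqr_ge0// ler_wpM2l.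
apply: (affine_minorant_ge0 sE).
- exact: hessian_ge0 df cf (x + t *: v) u.
- exact: le_trans (derive3_le v u u y x) (le_c _ yx).
- exact: le_trans (derive3_le v u u x y) (le_c _ xy).
Qed.

End third.

(** For large positive [t] the slope [b + c] decides the sign; if it were negative, the chosen [t]
    would give the value [-1]. *)
Lemma affine_abs_ge0 (a b c : R) :
  (forall t : R, 0 <= a + t * b + `|t| * c) -> - c <= b.
Proof.
move=> H; rewrite leNgt; apply/negP => bc.
have a0 : 0 <= a by have := H 0; rewrite normr0 !mul0r !addr0.
pose t := (a + 1) / (- (b + c)).
have bc0 : 0 < - (b + c) by lra.
have t0 : 0 < t by rewrite divr_gt0//; lra.
have := H t; rewrite gtr0_norm// -addrA -mulrDr.
have -> : t * (b + c) = - (a + 1).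
  by rewrite /t; field; lra.
lra.
Qed.

(** Evaluation at the minimizer [- b / (2 * c)] gives the discriminant inequality. If [c = 0], an
    affine function bounded below on the whole line has slope 0. *)
Lemma quadratic_ge0 (a b c : R) : 0 <= c ->
  (forall t : R, 0 <= a + t * b + t ^+ 2 * c) -> b ^+ 2 <= 4 * a * c.
Proof.
rewrite le_eqVlt => /orP[/eqP <-|c0] H.
  have : - 0 <= b.
    by apply: (@affine_abs_ge0 a) => t; have := H t; rewrite !mulr0.
  have : - 0 <= - b.
    apply: (@affine_abs_ge0 a) => t; have := H (- t).
    by rewrite mulNr mulrN !mulr0.
  move=> bN bP; have -> : b = 0 by lra.
  by rewrite expr0n mulr0.
have := H (- b / (2 * c)).
have -> : a + - b / (2 * c) * b + (- b / (2 * c)) ^+ 2 * c =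
   (4 * a * c - b ^+ 2) / (4 * c) by field; lra.
by rewrite pmulr_lge0 ?invr_gt0 ?mulr_gt0// subr_ge0.
Qed.

(** Two mean value steps reduce the residual to a third derivative in directions [u, u, v]. For
    [nu = 0] the error in [hessian_line_ge0] is linear in [|t|], so [t] going to infinity bounds
    that derivative below; replacing [v] by [- v] bounds it above. *)
Lemma taylor_residual3_le (M : R) x u : 0 <= M ->
  holder_constant f 3 0 = M%:E ->
  dual_norm (taylor_residual x u) <= M * `|u| ^+ 2.
Proof.
move=> M0 Mf; apply: dual_norm_ub => [|v]; first by rewrite mulr_ge0// sqr_ge0.
have [t /andP[t0 t1] ->] := taylor_residual_mvt x u v.
have [s _ ->] := mvt_line x (t *: u) (td_diff3 Mf u v).
set y := x + _.
rewrite deriveZv; last exact: (td_diff3 Mf).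
rewrite (derive3_swap Mf).
have b3 w : - (M * (`|w| * `|u| ^+ 2)) <= 'D_w ('D_u ('D_u f)) y.
  apply: (@affine_abs_ge0 ('D_u ('D_u f) y)) => r.
  have := @hessian_line_ge0 M 0 (lexx 0) M0 Mf y u w r.
  by rewrite powRr0 mulr1.
have := b3 (- v); rewrite normrN -(scaleN1r v) deriveZv; last exact: (td_diff3 Mf).
rewrite mulN1r lerN2 => H.
have c0 : 0 <= M * (`|v| * `|u| ^+ 2) by rewrite !mulr_ge0.
rewrite (_ : M * _ * _ = M * (`|v| * `|u| ^+ 2)); last by ring.
apply: le_trans (ler_wpM2l (ltW t0) H) _.
exact: ler_piMl c0 (ltW t1).
Qed.

(** For [nu = 1] the error in [hessian_line_ge0] is quadratic in [t], and the discriminant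
    inequality bounds the third derivative at [x] by the square root term. Moving from [x] to the
    intermediate point [y] adds the term with [M * |u| ^+ 2]. *)
Lemma taylor_residual4_le (M : R) x u : 0 <= M ->
  holder_constant f 3 1 = M%:E ->
  dual_norm (taylor_residual x u) <=
    (2 * Num.sqrt (M * hessian f x u u) + M * `|u| ^+ 2) * `|u|.
Proof.
move=> M0 Mf; rewrite hessianE//.
have A0 := hessian_ge0 df cf x u.
have sq0 : 0 <= M * 'D_u ('D_u f) x by rewrite mulr_ge0.
apply: dual_norm_ub => [|v].
  by rewrite !(mulr_ge0, addr_ge0)// sqrtr_ge0.
have [t /andP[t0 t1] ->] := taylor_residual_mvt x u v.
have [s /andP[s0 s1] ->] := mvt_line x (t *: u) (td_diff3 Mf u v).
set y := x + _.
rewrite deriveZv; last exact: (td_diff3 Mf).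
have H1 := @derive3_le M 1 M0 Mf u u v y x.
have yx : `|y - x| <= `|u|.
  rewrite /y addrAC subrr add0r !scalerA normrZ ler_piMl// normrM.
  by rewrite !gtr0_norm// mulr_ile1 ?ltW.
rewrite powRr1// in H1.
have line r : 0 <= 'D_u ('D_u f) x + r * 'D_u ('D_u ('D_v f)) x +
    `|r| * (M * (`|r| * `|v|) `^ 1 * (`|v| * `|u| ^+ 2)).
  exact: (eq_ind_r (fun d => 0 <= 'D_u ('D_u f) x + r * d +
    `|r| * (M * (`|r| * `|v|) `^ 1 * (`|v| * `|u| ^+ 2)))
    (@hessian_line_ge0 M 1 ler01 M0 Mf x u v r) (derive3_swap Mf u v x)).
have {line}H2 : 'D_u ('D_u ('D_v f)) x ^+ 2 <=
    4 * 'D_u ('D_u f) x * (M * `|v| * (`|v| * `|u| ^+ 2)).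
  apply: quadratic_ge0 => [|r]; first by rewrite !mulr_ge0.
  apply: le_trans (line r) _; rewrite lerD2l powRr1 ?mulr_ge0//.
  by rewrite -(real_normK (num_real r)) le_eqVlt; apply/orP; left; apply/eqP; ring.
move: H2 H1 A0 sq0; set d3x : R := 'D_u _ x; set d3y : R := 'D_u _ y.
set A : R := 'D_u _ x => H2 H1 A0 sq0.
set S := Num.sqrt _; have S0 : 0 <= S by exact: sqrtr_ge0.
have H3 : d3x <= 2 * S * `|u| * `|v|.
  apply: le_trans (ler_norm _) _.
  rewrite -(ler_pXn2r (n := 2)) ?nnegrE ?mulr_ge0// real_normK ?num_real//.
  apply: (le_trans H2); rewrite !exprMn (sqr_sqrtr sq0).
  by rewrite le_eqVlt; apply/orP; left; apply/eqP; ring.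
have H4 : d3y <= (2 * S + M * `|u| ^+ 2) * `|u| * `|v|.
  have : M * `|y - x| * (`|u| * `|u| * `|v|) <= M * `|u| * (`|u| * `|u| * `|v|).
    by rewrite ler_wpM2r ?mulr_ge0// ler_wpM2l.
  move: H1 H3; clear; move: `|u| `|v| `|y - x| S => a b c d; nra.
apply: le_trans (ler_wpM2l (ltW t0) H4) (ler_piMl _ (ltW t1)).
by rewrite !(mulr_ge0, addr_ge0)// sqrtr_ge0.
Qed.

End taylor_residual.

(** * The regularized Newton step *)

(** Bilinear algebra with [G], [h], [b] standing for the gradient, the Hessian and [B]. The
    coefficient of [t] is arranged so that [step_subgradient] at [d] appears. *)
Lemma quadratic_expand (R : realType) (V : lmodType R) (G : V -> R)
    (h b : V -> V -> R) (l t : R) (u d : V) :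
  (forall t x y, G (x + t *: y) = G x + t * G y) ->
  (forall x y, h x y = h y x) -> (forall x y, b x y = b y x) ->
  (forall t x y z, h x (y + t *: z) = h x y + t * h x z) ->
  (forall t x y z, b x (y + t *: z) = b x y + t * b x z) ->
  G (u + t *: d) + 2^-1 * h (u + t *: d) (u + t *: d)
    + l / 2 * b (u + t *: d) (u + t *: d) =
  G u + 2^-1 * h u u + l / 2 * b u u - t * - (G d + h u d + l * b u d)
    + t ^+ 2 * (2^-1 * h d d + l / 2 * b d d).
Proof.
move=> GD hC bC hD bD; rewrite GD !hD !bD !(hC (_ + _)) !(bC (_ + _)) !hD !bD.
by rewrite (hC d u) (bC d u); field.
Qed.

Section newton_step.
Context (R : realType) (E : vectType R) (B : spd_operator E).
Local Notation V := (euclidean B).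
Variables (f : V -> R) (psi : V -> \bar R).
Hypotheses (df : times_differentiable 2 f) (cf : convex_function setT f).
Hypothesis cpsi : proper_closed_convex psi.
Implicit Types (x y z u v : V).

Lemma edom_fin_num x : edom psi x -> psi x \is a fin_num.
Proof.
by case: cpsi => pN _ _ _; rewrite fin_numE pN /edom /= lt_neqAle => /andP[].
Qed.

Lemma epigraph_convex x y (a b t : R) : 0 <= t <= 1 ->
  (psi x <= a%:E)%E -> (psi y <= b%:E)%E ->
  (psi (x + t *: (y - x))%R <= (a + t * (b - a))%:E)%E.
Proof.
case: cpsi => _ _ _ cE /andP[t0 t1] xa yb.
have := @cE (y, b) (x, a) (Itv01 t0 t1) (mem_set yb) (mem_set xa).
rewrite inE; set p := conv _ _ _.
have -> : p = (t *: y + (1 - t) *: x, t * b + (1 - t) * a) by [].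
rewrite /epigraph /=.
have -> : t *: y + (1 - t) *: x = x + t *: (y - x).
  by rewrite scalerBl scale1r scalerBr addrCA.
by have -> : t * b + (1 - t) * a = a + t * (b - a) by ring.
Qed.

Section step.
Variables (x : V) (lambda : R).
Hypothesis lambda0 : 0 < lambda.

Definition quadratic_model y : R := gradient f x (y - x)
  + 2^-1 * hessian f x (y - x) (y - x) + lambda / 2 * `|y - x| ^+ 2.

Lemma newton_modelE y :
  newton_model f psi x lambda y = ((quadratic_model y)%:E + psi y)%E.
Proof. by []. Qed.

Lemma quadratic_model0 : quadratic_model x = 0.
Proof. by rewrite /quadratic_model subrr !linear0 normr0 expr0n !mulr0 !addr0. Qed.

Lemma step_subgradientE y d : step_subgradient f x lambda y d =
  - (gradient f x d + hessian f x (y - x) d + lambda * B (y - x) d) :> R.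
Proof.
rewrite /step_subgradient !add_lfunE !opp_lfunE scale_lfunE /riesz.
by rewrite /GRing.scale /= !opprD.
Qed.

(** The slope of the model at [y] is minus [step_subgradient]; optimality of [y] can thus be read as
    a subgradient inequality for [psi]. *)
Lemma quadratic_model_line y d (t : R) :
  quadratic_model (y + t *: d) = quadratic_model y
    - t * step_subgradient f x lambda y d
    + t ^+ 2 * (2^-1 * hessian f x d d + lambda / 2 * `|d| ^+ 2).
Proof.
have hD s a b c : hessian f x a (b + s *: c) =
    hessian f x a b + s * hessian f x a c :> R.
  exact: etrans (linearD (hessian f x a) b (s *: c))
    (congr1 (+%R _) (linearZ_LR (hessian f x a) s c)).
have bDr (a b c : V) : B a (b + c) = B a b + B a c :> R by exact: linearD.
have bD s (a b c : V) : B a (b + s *: c) = B a b + s * B a c :> R.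
  by rewrite bDr spd_opZr.
have gD s (b c : V) : gradient f x (b + s *: c) =
    gradient f x b + s * gradient f x c :> R by rewrite linearD linearZ.
rewrite step_subgradientE /quadratic_model (addrAC y) !euclidean_norm_sqr.
exact: (@quadratic_expand _ V (gradient f x) (fun a b => hessian f x a b)
  (fun a b => B a b) lambda t (y - x) d gD (hessian_sym df x) (spd_op_sym B) hD bD).
Qed.

(** Divide by [t] and let [t] tend to 0; the [t] chosen below satisfies [t * b <= - a / 2], enough
    for a contradiction. *)
Lemma small_step_ge0 (a b : R) :
  (forall t, 0 < t <= 1 -> 0 <= t * a + t ^+ 2 * b) -> 0 <= a.
Proof.
move=> H; rewrite leNgt; apply/negP => a0.
have b0 : 0 < b by have := H 1; rewrite ltr01 lexx => /(_ isT); lra.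
pose t := Num.min 1 (- a / (2 * b)).
have t0 : 0 < t by rewrite lt_min ltr01 divr_gt0 ?mulr_gt0// oppr_gt0.
have := H t; rewrite t0 ge_min lexx => /(_ isT).
rewrite expr2 -mulrA -mulrDr pmulr_rge0//.
have : t * b <= - a / 2.
  by rewrite -ler_pdivlMr// /t ge_min orbC -mulrA -invfM lexx.
lra.
Qed.

Lemma newton_step_dom y : edom psi x -> newton_step f psi x lambda y -> edom psi y.
Proof.
move=> xdom /(_ x); rewrite !newton_modelE quadratic_model0 add0e.
move=> /le_lt_trans/(_ xdom); rewrite /edom /=.
by case: (psi y) => [r| |]; rewrite ?addey ?addeNy ?ltry ?ltNyr ?ltxx.
Qed.

(** First-order optimality: compare [y] with [y + t *: (z - y)], bound [psi] there by its chord, and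
    use small [t]. *)
Lemma newton_step_subgradient y : edom psi x -> newton_step f psi x lambda y ->
  subdifferential psi y (step_subgradient f x lambda y).
Proof.
move=> xdom ystep; have ydom := newton_step_dom xdom ystep.
split=> // z; case: (eqVneq (psi z) +oo%E) => [->|zoo]; first exact: leey.
have zdom : edom psi z by rewrite /edom /= lt_neqAle zoo leey.
rewrite -(fineK (edom_fin_num ydom)) -(fineK (edom_fin_num zdom)) -EFinD lee_fin.
rewrite -subr_ge0; set b := fine _; set a := fine _.
rewrite opprD addrA.
apply: (@small_step_ge0 _ (2^-1 * hessian f x (z - y) (z - y) +
  lambda / 2 * `|z - y| ^+ 2)) => t /andP[t0 t1].
have t01 : 0 <= t <= 1 by rewrite ltW.
have ya : (psi y <= a%:E)%E by rewrite fineK ?edom_fin_num.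
have zb : (psi z <= b%:E)%E by rewrite fineK ?edom_fin_num.
have := ystep (y + t *: (z - y)); rewrite !newton_modelE.
move=> /le_trans/(_ (leeD2l _ (epigraph_convex t01 ya zb))).
rewrite -(fineK (edom_fin_num ydom)) -/a -!EFinD lee_fin quadratic_model_line.
rewrite -subr_ge0 => /le_trans; apply; rewrite le_eqVlt; apply/orP; left.
by apply/eqP; ring.
Qed.

End step.
End newton_step.

(** * Existence of the regularized Newton step *)

Section newton_step_existence.
Context (R : realType) (E : vectType R) (B : spd_operator E).
Local Notation V := (euclidean B).
Variables (f : V -> R) (psi : V -> \bar R).
Hypotheses (df : times_differentiable 2 f) (cf : convex_function setT f).
Hypothesis cpsi : proper_closed_convex psi.
Variables (x : V) (lambda : R).
Hypothesis lambda0 : 0 < lambda.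
Implicit Types (y z d : V) (s : dual_space V).

Lemma hessian_form_continuous : continuous (fun d : V => hessian f x d d : R).
Proof.
pose e := vbasis (fullv : {vspace E}).
pose c i : dual_space V := linfun (coord e i : {linear _ -> R^o}).
have cE i d : c i d = coord e i d by rewrite lfunE.
have -> : (fun d : V => hessian f x d d : R) =
    (fun d => \sum_i (c i d * hessian f x d e`_i : R)).
  apply/funext => d; rewrite {2}(coord_vbasis (memvf (d : E))) linear_sum.
  by apply: eq_bigr => i _; rewrite cE; exact: linearZ.
apply: (@continuous_big R _ +%R 0 xpredT _ V) => [|i _ d].
  exact: (@pseudometric_normed_Zmodule.add_continuous _ R).
apply: (@cvgM R V (nbhs d) (nbhs_filter d)); first exact: dual_continuous.
have -> : (fun d : V => hessian f x d e`_i : R) = hessian f x e`_i.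
  by apply/funext => z; exact: hessian_sym.
rewrite hessian_sym//; exact: dual_continuous.
Qed.

Lemma quadratic_model_continuous : continuous (quadratic_model f x lambda).
Proof.
pose q d : R := gradient f x d + 2^-1 * hessian f x d d + lambda / 2 * `|d| ^+ 2.
have cq : continuous q.
  move=> d; have Fd := nbhs_filter d.
  apply: (@cvgD _ R V (nbhs d)).
    apply: (@cvgD _ R V (nbhs d)); first exact: dual_continuous.
    apply: (@cvgM R V (nbhs d)); first exact: (@cvg_cst R _ V (nbhs d)).
    exact: hessian_form_continuous.
  apply: (@cvgM R V (nbhs d)); first exact: (@cvg_cst R _ V (nbhs d)).
  have cn : `|z| @[z --> d] --> `|d|.
    exact: (@cvg_norm _ V V (nbhs d) Fd id d (@cvg_id _ _)).
  exact: (@cvgM R V (nbhs d) _ _ _ _ _ cn cn).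
move=> y; apply: (@continuous_comp _ _ _ (fun z : V => z - x) q y); last exact: cq.
apply: (@cvgB _ V V (nbhs y) (nbhs_filter y) id (cst x)); first exact: cvg_id.
exact: (@cvg_cst V x V (nbhs y) (nbhs_filter y)).
Qed.

(** A rejected exponent carries information only if its model has a minimizer. Since [psi] may be
    discontinuous, the continuous function [quadratic_model + r] is minimized over a compact piece
    of the epigraph. *)
Lemma newton_step_exists s :
  subdifferential psi x s -> exists y, newton_step f psi x lambda y.
Proof.
move=> [xdom xs]; have [_ _ cE _] := cpsi.
set a := fine (psi x).
have xa : psi x = a%:E by rewrite /a fineK// edom_fin_num.
pose n1 := dual_norm (gradient f x); pose n2 := dual_norm s.
have n10 : 0 <= n1 by exact: dual_norm_ge0.
have n20 : 0 <= n2 by exact: dual_norm_ge0.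
(* If the model at [z] does not exceed its value at [x], then [lambda / 2 * |z - x| ^+ 2 <= (n1 +
   n2) * |z - x|], because [psi] lies above the affine function of slope [s]. *)
pose rho := 2 * (n1 + n2) / lambda.
pose C := epigraph psi `&`
  ([set z : V | `|z - x| <= rho] `*` `[(a - n2 * rho), (a + n1 * rho)]).
have cC : compact C.
  rewrite /C setIC; apply: compact_closedI; last exact: cE.
  apply: compact_setX; [exact: compact_ball|exact: segment_compact].
have rho0 : 0 <= rho by rewrite divr_ge0 ?(ltW lambda0)// mulr_ge0// addr_ge0.
have Cx : C (x, a).
  split; first by rewrite /epigraph /= xa.
  split => /=; first by rewrite subrr normr0.
  rewrite in_itv /= gerBl lerDl; apply/andP; split; exact: mulr_ge0.
pose g (p : V * R^o) : R := quadratic_model f x lambda p.1 + p.2.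
have cg : continuous g.
  move=> p; have Fp := nbhs_filter p.
  apply: (@cvgD _ R (V * R^o)%type (nbhs p)); last exact: cvg_snd.
  apply: (@continuous_comp _ _ _ (fst : V * R^o -> V) (quadratic_model f x lambda) p).
    exact: cvg_fst.
  exact: quadratic_model_continuous.
have [[y r] /set_mem[yr _] ymin] := @compact_EVT_min _ _ g C
  (ex_intro _ (x, a) Cx) cC (continuous_subspaceT cg).
exists y => z; rewrite !newton_modelE.
have yle : (psi y <= r%:E)%E by [].
apply: (le_trans (leeD2l _ yle)); rewrite -EFinD.
case: (eqVneq (psi z) +oo%E) => [->|zoo]; first by rewrite addey// leey.
have zdom : edom psi z by rewrite /edom /= lt_neqAle zoo leey.
rewrite -(fineK (edom_fin_num cpsi zdom)) -EFinD lee_fin; set b := fine _.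
have zb : psi z = b%:E by rewrite fineK// edom_fin_num.
(* A competitor worse than [x] loses to [(x, a)], which belongs to [C]; any other one lies in [C]
   itself. *)
have [zle|/ltW] := leP (quadratic_model f x lambda z + b) a; last first.
  apply: le_trans; have := ymin (x, a) (mem_set Cx).
  by rewrite /g /= quadratic_model0 add0r.
suff Cz : C (z, b) by exact: ymin (z, b) (mem_set Cz).
have bge : a - n2 * `|z - x| <= b.
  have := xs z; rewrite xa zb -EFinD lee_fin; apply: le_trans.
  rewrite lerD2l lerNl -[- s _](linearN s) /= -normrN.
  exact: dual_norm_le.
have qge : - n1 * `|z - x| + lambda / 2 * `|z - x| ^+ 2 <=
    quadratic_model f x lambda z.
  rewrite /quadratic_model lerD2r -[leLHS]addr0 lerD//.
    by have := ler_dual_norm (gradient f x) (z - x);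
      rewrite ler_norml mulNr => /andP[].
  by rewrite mulr_ge0// hessianE// hessian_ge0.
have zrho : `|z - x| <= rho.
  have [->|nz] := eqVneq `|z - x| 0; first exact: rho0.
  have nz0 : 0 < `|z - x| by rewrite lt_def nz normr_ge0.
  rewrite /rho ler_pdivlMr// -(ler_pM2l nz0).
  clear -bge qge zle; lra.
split; first by rewrite /epigraph /= zb.
split => //=; rewrite in_itv /=; apply/andP; split.
  apply: le_trans bge; rewrite lerD2l lerN2 ler_wpM2l//.
have H1 : n1 * `|z - x| <= n1 * rho by rewrite ler_wpM2l.
have H2 : 0 <= lambda / 2 * `|z - x| ^+ 2.
  by rewrite mulr_ge0 ?sqr_ge0// divr_ge0 ?(ltW lambda0).
suff H3 : b <= a + n1 * rho :> R by exact: H3.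
clear -H1 H2 qge zle; lra.
Qed.

End newton_step_existence.

(** * Step length, acceptance test and decrease of the objective *)

Section acceptance.
Context (R : realType) (E : vectType R) (B : spd_operator E).
Local Notation V := (euclidean B).
Variables (f : V -> R) (psi : V -> \bar R).
Hypotheses (df : times_differentiable 2 f) (cf : convex_function setT f).
Hypothesis cpsi : proper_closed_convex psi.
Variables (x : V) (s : dual_space V).
Hypothesis xs : subdifferential psi x s.
Variables (lambda : R) (y : V).
Hypotheses (lambda0 : 0 < lambda) (ystep : newton_step f psi x lambda y).

Let g := dual_norm (gradient f x + s).
Let S := step_subgradient f x lambda y.
Let F' := gradient f y + S.

Let ys : subdifferential psi y S.
Proof. by apply: (newton_step_subgradient df cpsi) ystep => //; case: xs. Qed.

Lemma subdifferential_fine z (t : dual_space V) w : subdifferential psi z t ->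
  edom psi w -> fine (psi z) + t (w - z) <= fine (psi w).
Proof.
move=> [zdom zt] wdom; rewrite -lee_fin EFinD !fineK ?edom_fin_num//.
Qed.

(** Adding the subgradient inequalities of [s] at [x] and of [S] at [y] cancels the values of [psi];
    Cauchy-Schwarz bounds what is left of the gradient term. *)
Lemma step_energy :
  hessian f x (y - x) (y - x) + lambda * `|y - x| ^+ 2 <= g * `|y - x|.
Proof.
have arith (a b h c d e k l : R) : b + d <= a -> a + - - (c + h + l * e) <= b ->
    - (c + d) <= k -> h + l * e <= k by lra.
have [xdom _] := xs; have [ydom _] := ys.
have H1 := subdifferential_fine xs ydom.
have H2 := subdifferential_fine ys xdom.
have SE := step_subgradientE f x lambda y (y - x).
have NE : S (x - y) = - S (y - x) :> R by rewrite -(opprB y x) linearN.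
have : - ((gradient f x + s) (y - x)) <= g * `|y - x|.
  by apply: le_trans (ler_dual_norm _ _); rewrite -normrN ler_norm.
have -> : (gradient f x + s) (y - x) = gradient f x (y - x) + s (y - x) :> R.
  by rewrite add_lfunE.
move: H1 H2; rewrite -/S NE SE -euclidean_norm_sqr.
set a := fine _; set b := fine _; set h := hessian _ _ _ _.
set c := gradient _ _ _; set d := s _; set e := _ ^+ 2; set k := g * _.
exact: arith.
Qed.

Lemma step_length : lambda * `|y - x| <= g.
Proof.
have [->|nz] := eqVneq `|y - x| 0; first by rewrite mulr0 dual_norm_ge0.
have nz0 : 0 < `|y - x| by rewrite lt_def nz normr_ge0.
rewrite -(ler_pM2r nz0) -mulrA -expr2; apply: le_trans step_energy.
by rewrite lerDr hessianE// hessian_ge0.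
Qed.

(** The residual equals [F' + lambda *: riesz (y - x)]. Squaring the assumption cancels
    [lambda ^+ 2 * |y - x| ^+ 2] and yields the acceptance test with a factor 2 to spare. *)
Lemma residual_accepts :
  dual_norm (taylor_residual f x (y - x)) <= lambda * `|y - x| ->
  accepts f x lambda y.
Proof.
move=> Hres; rewrite /accepts -/S -/F'.
have resE : taylor_residual f x (y - x) = F' + lambda *: riesz (y - x).
  rewrite /taylor_residual (addrC x) subrK /F' /S /step_subgradient.
  by rewrite -[RHS]addrA subrK addrA.
have NE : F' (x - y) = - F' (y - x) :> R by rewrite -(opprB y x) linearN.
have : dual_norm (taylor_residual f x (y - x)) ^+ 2 <= (lambda * `|y - x|) ^+ 2.
  by rewrite ler_pXn2r// nnegrE ?dual_norm_ge0// mulr_ge0// ltW.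
rewrite resE dual_norm_add_riesz exprMn NE gerDr => H.
rewrite ler_pdivrMl ?mulr_gt0//.
have N0 := sqr_ge0 (dual_norm F').
lra.
Qed.

(** [F'] is a subgradient of the objective at [y], so the decrease is at least [F' (x - y)]. *)
Lemma accepts_decrease : accepts f x lambda y ->
  dual_norm F' ^+ 2 / (4 * lambda) <=
    f x + fine (psi x) - (f y + fine (psi y)).
Proof.
rewrite /accepts -/S -/F' mulrC => /le_trans; apply.
have H1 := subdifferential_fine ys xs.1.
have H2 := convex_gradient_le df cf y x.
have -> : F' (x - y) = gradient f y (x - y) + S (x - y) :> R by rewrite add_lfunE.
lra.
Qed.

(** Cauchy-Schwarz in the acceptance test gives [dual_norm F' <= 4 * lambda * |y - x|], and
    [step_length] applies. *)
Lemma accepts_norm_le : accepts f x lambda y -> dual_norm F' <= 4 * g.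
Proof.
rewrite /accepts -/S -/F' => H.
have [->|nz] := eqVneq (dual_norm F') 0; first by rewrite mulr_ge0// dual_norm_ge0.
have nz0 : 0 < dual_norm F' by rewrite lt_def nz dual_norm_ge0.
have := le_trans H (dual_norm_le F' (x - y)).
rewrite expr2 mulrCA ler_pM2l// ler_pdivrMl ?mulr_gt0// distrC -mulrA => /le_trans.
by apply; rewrite ler_pM2l// step_length.
Qed.

Lemma accepts2 (M : R) : 0 <= M -> holder_constant f 2 0 = M%:E ->
  6 * M <= lambda -> accepts f x lambda y.
Proof.
move=> M0 Mf Ml; apply: residual_accepts.
apply: le_trans (taylor_residual2_le df _ _ M0 Mf) _.
by rewrite ler_wpM2r//; lra.
Qed.

Lemma accepts3 (M : R) : 0 <= M -> holder_constant f 3 0 = M%:E ->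
  6 * M * g <= lambda ^+ 2 -> accepts f x lambda y.
Proof.
move=> M0 Mf Ml; apply: residual_accepts.
apply: le_trans (taylor_residual3_le df cf _ _ M0 Mf) _.
rewrite expr2 mulrA ler_wpM2r// -(ler_pM2l lambda0) mulrCA -expr2.
have g0 : 0 <= g by exact: dual_norm_ge0.
have : M * (lambda * `|y - x|) <= M * g by rewrite ler_wpM2l// step_length.
have : 0 <= M * g by rewrite mulr_ge0.
lra.
Qed.

Lemma accepts4 (M : R) : 0 <= M -> holder_constant f 3 1 = M%:E ->
  6 * M * g ^+ 2 <= lambda ^+ 3 -> accepts f x lambda y.
Proof.
move=> M0 Mf Ml; apply: residual_accepts.
apply: le_trans (taylor_residual4_le df cf _ _ M0 Mf) _.
rewrite ler_wpM2r//.
have g0 : 0 <= g by exact: dual_norm_ge0.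
have l2 : 0 < lambda ^+ 2 by rewrite exprn_gt0.
have len := step_length.
have e : hessian f x (y - x) (y - x) <= g * `|y - x|.
  apply: le_trans step_energy; rewrite lerDl mulr_ge0 ?sqr_ge0//; exact: ltW.
have H1 : M * `|y - x| ^+ 2 <= 6^-1 * lambda.
  rewrite -(ler_pM2l l2) (_ : _ * (M * _) = M * (lambda * `|y - x|) ^+ 2); last by ring.
  have : M * (lambda * `|y - x|) ^+ 2 <= M * g ^+ 2.
    by rewrite ler_wpM2l// ler_pXn2r// nnegrE mulr_ge0// ltW.
  rewrite (_ : lambda ^+ 2 * _ = 6^-1 * lambda ^+ 3); last by ring.
  lra.
(* The fraction 5/12 has square 25/144, which exceeds 1/6, and [2 * (5 / 12) + 1 / 6 = 1]; the two
   parts of the residual bound thus add up to [lambda]. *)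
have H2 : M * hessian f x (y - x) (y - x) <= (5 / 12 * lambda) ^+ 2.
  apply: le_trans (ler_wpM2l M0 e) _.
  rewrite -(ler_pM2l lambda0).
  rewrite (_ : _ * (M * _) = M * g * (lambda * `|y - x|)); last by ring.
  have : M * g * (lambda * `|y - x|) <= M * g ^+ 2.
    rewrite (_ : M * g ^+ 2 = M * g * g); last by ring.
    by rewrite ler_wpM2l// mulr_ge0.
  have : 0 <= lambda ^+ 3 by rewrite exprn_ge0// ltW.
  rewrite (_ : lambda * (5 / 12 * lambda) ^+ 2 = 25 / 144 * lambda ^+ 3); last by field.
  lra.
have : Num.sqrt (M * hessian f x (y - x) (y - x)) <= 5 / 12 * lambda.
  rewrite (le_trans (ler_wsqrtr H2))// sqrtr_sqr ger0_norm//.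
  by rewrite mulr_ge0 ?(ltW lambda0)// divr_ge0.
lra.
Qed.

End acceptance.

(** * Real sequences *)

Section rates.
Variable R : realType.
Implicit Types (p c a : nat -> R).

Lemma exprB_le (n : nat) (x y : R) : 0 <= y -> y <= x ->
  x ^+ n.+1 - y ^+ n.+1 <= n.+1%:R * x ^+ n * (x - y).
Proof.
move=> y0 yx; have x0 : 0 <= x by exact: le_trans yx.
elim: n => [|n IH]; first by rewrite !expr1 expr0 !mul1r.
have H1 : x * (x ^+ n.+1 - y ^+ n.+1) <= x * (n.+1%:R * x ^+ n * (x - y)).
  by rewrite ler_wpM2l.
have H2 : y ^+ n.+1 * (x - y) <= x ^+ n.+1 * (x - y).
  by rewrite ler_wpM2r ?subr_ge0// lerXn2r// nnegrE.
have -> : x ^+ n.+2 - y ^+ n.+2 =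
    x * (x ^+ n.+1 - y ^+ n.+1) + y ^+ n.+1 * (x - y).
  by rewrite !(exprS _ n.+1); ring.
apply: le_trans (lerD H1 H2) _; rewrite le_eqVlt; apply/orP; left; apply/eqP.
by rewrite -(natr1 n.+1) !(exprS x n); ring.
Qed.

Lemma sublinear_rate a (K : R) (k : nat) : (1 <= k)%N -> 0 < K ->
  (forall i, 0 <= a i) -> a 1%N <= 2 * K ->
  (forall i, a i.+1 ^+ 2 <= K * (a i - a i.+1)) -> a k <= 2 * K / k%:R.
Proof.
move=> + K0 a0 a1 aS; case: k => // k _.
elim: k => [|k IH]; first by rewrite divr1.
rewrite leNgt; apply/negP; rewrite ltr_pdivrMr ?ltr0Sn// => Am.
have m1 : 1 <= k.+1%:R :> R by rewrite ler1n.
move: IH; rewrite ler_pdivlMr ?ltr0Sn// => bm.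
move: Am (aS k.+1) (a0 k.+2) m1 bm; rewrite -(natr1 k.+1).
move: (k.+1%:R : R) (a k.+1) (a k.+2) => m b A Am AS A0 m1 bm.
have Agt0 : 0 < A by nra.
(* Multiplying the recurrence by [m] and using [b * m <= 2 * K < A * (m + 1)] gives
   [A ^+ 2 * m < K * A]. With [1 <= m] this yields [A * (m + 1) < 2 * K], a contradiction. *)
have : A * m < K by rewrite -(ltr_pM2l Agt0); nra.
nra.
Qed.

(* [e^y = e^(-1/2) e^(y + 1/2)], both factors being bounded below by tangents *)
Lemma expR_half_le (y : R) : 2^-1 * (1 + y + 2^-1) <= expR y.
Proof.
have [neg|pos] := ltP (1 + y + 2^-1) 0.
  by rewrite (le_trans _ (expR_ge0 _))// mulr_ge0_le0// ltW.
have -> : expR y = expR (- 2^-1) * expR (y + 2^-1) by rewrite -expRD addrC addrK.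
apply: ler_pM => //; last by rewrite -addrA expR_ge1Dx.
by apply: le_trans (expR_ge1Dx _); lra.
Qed.

(* Meant for [p], [c], [d] the [n.+1]-th roots of the gap, of [g] and of [D]: this
   avoids real exponents. *)
Lemma log_sum_rate p c (n k : nat) (K d : R) : 0 < K -> 0 < d ->
  (forall i, (i <= k)%N -> 0 < p i) -> (forall i, (i <= k)%N -> 0 < c i) ->
  (forall i, (i <= k)%N -> p i <= c i * d) ->
  (forall i, (i < k)%N -> c i.+1 ^+ (2 * n.+1) <=
    K * c i ^+ n * (p i ^+ n.+1 - p i.+1 ^+ n.+1)) ->
  4 * n.+1%:R * (ln (c 0%N * d) - ln (p k)) <= k%:R ->
  k%:R * p k <= 2 * n.+1%:R * K * d ^+ n.+2.
Proof.
move=> K0 d0 p0 c0 pc step logk.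
set N : R := n.+1%:R in logk *.
have N0 : 0 < N by rewrite ltr0Sn.
have pmono i : (i < k)%N -> p i.+1 <= p i.
  move=> ik; have ik' := ltnW ik.
  rewrite -(ler_pXn2r (n := n.+1))// ?nnegrE ?(ltW (p0 _ _))//.
  rewrite -subr_ge0 -(pmulr_rge0 _ (mulr_gt0 K0 (exprn_gt0 n (c0 i ik')))).
  by apply: le_trans (step i ik); rewrite exprn_ge0// ltW// c0.
pose Q := N * K * d ^+ n.+2.
have Q0 : 0 < Q by rewrite mulr_gt0 ?exprn_gt0 ?mulr_gt0.
(* The exponential of an increment of [l] is the product of the ratios of [c] to the power [n] and
   of [p] to the power [n.+1]. *)
pose l i := n%:R * ln (c i) + N * ln (p i).
(* Bounding [p i.+1 ^+ n.+2] through [p <= c * d] raises the exponent of [c i.+1] to [2 * n.+1], as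
   [step] requires; [exprB_le] then extracts the factor [p i - p i.+1]. *)
have term i : (i < k)%N ->
    expR (l i.+1 - l i) <= Q * ((p i.+1)^-1 - (p i)^-1).
  move=> ik; have ik' := ltnW ik.
  have P0 := p0 _ ik'; have P1 := p0 _ ik; have C0 := c0 _ ik'; have C1 := c0 _ ik.
  have -> : l i.+1 - l i = ln ((c i.+1 / c i) ^+ n * (p i.+1 / p i) ^+ n.+1).
    rewrite lnM ?posrE ?exprn_gt0 ?divr_gt0// !lnXn ?divr_gt0//.
    rewrite !ln_div ?posrE// /l /N -[_ *+ n]mulr_natl -[_ *+ n.+1]mulr_natl; ring.
  rewrite lnK ?posrE ?mulr_gt0 ?exprn_gt0 ?divr_gt0//.
  have S := step i ik.
  have S2 := exprB_le n (ltW P1) (pmono _ ik).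
  have S3 : p i.+1 ^+ n.+2 <= (c i.+1 * d) ^+ n.+2.
    by apply: lerXn2r (pc _ ik); rewrite nnegrE ltW// mulr_gt0.
  move: S S2 S3; rewrite -/N.
  move: (p i) (p i.+1) (c i) (c i.+1) P0 P1 C0 C1 => x y u v x0 y0 u0 v0 S S2 S3.
  have y0' := exprn_gt0 n y0.
  have -> : Q * (y^-1 - x^-1) = (v ^+ n * (K * u ^+ n *
      (N * x ^+ n * (x - y)) * d ^+ n.+2)) / (v ^+ n * u ^+ n * x ^+ n.+1 * y).
    rewrite /Q !(exprS x); field.
    by rewrite !gt_eqF ?exprn_gt0.
  rewrite ler_pdivlMr ?mulr_gt0 ?exprn_gt0//.
  have -> : (v / u) ^+ n * (y / x) ^+ n.+1 * (v ^+ n * u ^+ n * x ^+ n.+1 * y) =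
      v ^+ n * (v ^+ n * y ^+ n.+2).
    rewrite !expr_div_n !(exprS x) !(exprS y); field.
    by rewrite !gt_eqF ?exprn_gt0.
  rewrite ler_pM2l ?exprn_gt0//.
  apply: le_trans (ler_wpM2l (exprn_ge0 n (ltW v0)) S3) _.
  have -> : v ^+ n * (v * d) ^+ n.+2 = v ^+ (2 * n.+1) * d ^+ n.+2.
    by rewrite exprMn mulrA -exprD -addSnnS mul2n -addnn.
  apply: ler_wpM2r; first by rewrite exprn_ge0// ltW.
  apply: le_trans S _; rewrite ler_pM2l//.
  by rewrite mulr_gt0// exprn_gt0.
(* Summing [expR_half_le] over the increments telescopes both sides. *)
have sum_le j : (j <= k)%N ->
    2^-1 * (j%:R + (l j - l 0%N) + 2^-1 * j%:R) <= Q * ((p j)^-1 - (p 0%N)^-1).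
  elim: j => [|j IH] jk; first by rewrite !subrr mulr0 !addr0 !mulr0.
  have {}IH := IH (ltnW jk).
  have T := term j jk.
  have T2 := expR_half_le (l j.+1 - l j).
  have := le_trans T2 T; rewrite -(natr1 j); lra.
have {sum_le}S := sum_le k (leqnn k).
have pk0 := p0 k (leqnn k); have p00 := p0 _ (leq0n k).
have ck0 := c0 k (leqnn k); have c00 := c0 _ (leq0n k).
(* Both log ratios, of [c] and of [p], are at least [ln (p k) - ln (c 0 * d)]. The weights [n] and
   [N] are at most [N], and the assumption on [k] lets each contribute at least [- k / 4]. *)
have lk : - (2^-1 * k%:R) <= l k - l 0%N.
  have H1 : ln (p 0%N) <= ln (c 0%N * d).
    by rewrite ler_ln ?posrE ?mulr_gt0// pc.
  have H2 : ln (p k) - ln (c 0%N * d) <= ln (c k) - ln (c 0%N).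
    have : ln (p k) <= ln (c k * d) by rewrite ler_ln ?posrE ?mulr_gt0// pc.
    rewrite !lnM ?posrE//; lra.
  have H3 : n%:R * (ln (p k) - ln (c 0%N * d)) <= n%:R * (ln (c k) - ln (c 0%N)).
    by rewrite ler_wpM2l.
  have H4 : N * (ln (p k) - ln (c 0%N * d)) <= N * (ln (p k) - ln (p 0%N)).
    by rewrite ler_pM2l// lerD2l lerN2.
  have H5 : n%:R * (ln (c 0%N * d) - ln (p k)) <= N * (ln (c 0%N * d) - ln (p k)) \/
      ln (c 0%N * d) - ln (p k) < 0.
    have [?|?] := leP 0 (ln (c 0%N * d) - ln (p k)); [left|by right].
    by rewrite ler_wpM2r// ler_nat.
  have k0 : 0 <= k%:R :> R by [].
  have n0 : 0 <= n%:R :> R by [].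
  rewrite /l; case: H5 => H5; first by lra.
  have : n%:R * (ln (c 0%N * d) - ln (p k)) <= 0 by rewrite mulr_ge0_le0// ltW.
  lra.
have {S}S : 2^-1 * k%:R <= Q / p k.
  apply: le_trans (_ : Q * ((p k)^-1 - (p 0%N)^-1) <= _); last first.
    by rewrite ler_pM2l// gerBl invr_ge0 ltW.
  apply: le_trans S; rewrite ler_pM2l ?invr_gt0//; lra.
move: S; rewrite ler_pdivlMr// /Q; lra.
Qed.

End rates.

(** * Iterates of the method *)

Section trajectory.
Context (R : realType) (E : vectType R) (B : spd_operator E).
Local Notation V := (euclidean B).
Variables (f : V -> R) (psi : V -> \bar R).
Hypotheses (df : times_differentiable 2 f) (cf : convex_function setT f).
Hypothesis cpsi : proper_closed_convex psi.
Variables (alpha : R) (x : nat -> V) (dpsi : nat -> dual_space V) (H : nat -> R).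
Hypothesis alg : super_universal_newton f psi alpha x dpsi H.

Let g k := dual_norm (gradient f (x k) + dpsi k).
Let F k := f (x k) + fine (psi (x k)).

Lemma sun_subdifferential k : subdifferential psi (x k) (dpsi k).
Proof.
elim: k => [|k IH]; first exact: sun_init alg.
have [g0|gn0] := eqVneq (g k) 0; first by have [-> ->] := sun_stop alg g0.
have [j [ystep -> _ _ _]] := sun_step alg gn0.
by apply: (newton_step_subgradient df cpsi) ystep; case: IH.
Qed.

Lemma sun_norm_neq0 k : g k.+1 != 0 -> g k != 0.
Proof.
apply: contra_neq => g0; have [xk sk] := sun_stop alg g0.
by rewrite /g xk sk.
Qed.

Lemma sun_norm_gt0 k : g k != 0 -> 0 < g k.
Proof. by move=> gn0; rewrite lt_def gn0 dual_norm_ge0. Qed.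

Lemma sun_H_gt0 k : g k != 0 -> 0 < H k.
Proof.
elim: k => [_|k IH gS]; first exact: sun_H0 alg.
have gk := sun_norm_neq0 gS; have [j [_ _ _ _ ->]] := sun_step alg gk.
by rewrite divr_gt0// mulr_gt0 ?IH// exprn_gt0.
Qed.

Section regularization.
(* [n = q - 2], [M = M_q], [c = (6 M_q)^(1/(q-1))] *)
Variables (n : nat) (M c : R).
Let beta : R := n%:R / n.+1%:R.
Hypotheses (beta_alpha : beta <= alpha) (alpha1 : alpha <= 1).
Hypotheses (c0 : 0 <= c) (cM : c ^+ n.+1 = 6 * M).
Hypothesis H0c : H 0%N <= c * (g 0%N)^-1 `^ (alpha - beta).
Hypothesis accM : forall z s lambda y, subdifferential psi z s -> 0 < lambda ->
  newton_step f psi z lambda y ->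
  6 * M * dual_norm (gradient f z + s) ^+ n <= lambda ^+ n.+1 ->
  accepts f z lambda y.

Let beta_pow (r : R) : 0 <= r -> (r `^ beta) ^+ n.+1 = r ^+ n.
Proof.
move=> r0; rewrite -powR_mulrn ?powR_ge0// -powRrM /beta.
by rewrite divfK ?pnatr_eq0// powR_mulrn.
Qed.

(** Translates a bound on [H] into one on [lambda = H * g ^ alpha]; the exponent [alpha] cancels. *)
Let threshold (r : R) : 0 < r ->
  c * r^-1 `^ (alpha - beta) * r `^ alpha = c * r `^ beta.
Proof.
move=> r0; rewrite -mulrA; congr (_ * _).
rewrite -powR_inv1 ?(ltW r0)// -powRrM -powRD.
  by congr (_ `^ _); ring.
by apply/implyP => _; rewrite gt_eqF.
Qed.

(** If [j = 0], division by 4 turns the assumed bound into the claimed one. Otherwise [H k.+1] is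
    the value tried at exponent [j - 1], and its rejection shows, through [accM], that it lies below
    the threshold. *)
Lemma sun_step_bounds k : g k != 0 -> H k <= 4 * (c * (g k)^-1 `^ (alpha - beta)) ->
  exists2 lambda, 0 < lambda <= 4 * (c * g k `^ beta) &
  [/\ newton_step f psi (x k) lambda (x k.+1),
      dpsi k.+1 = step_subgradient f (x k) lambda (x k.+1),
      accepts f (x k) lambda (x k.+1) &
      H k.+1 <= c * (g k)^-1 `^ (alpha - beta)].
Proof.
move=> gn0 Hk; have gk := sun_norm_gt0 gn0.
have [j [ystep sE acc nacc HS]] := sun_step alg gn0.
rewrite -/(g k) in ystep sE acc nacc.
have Hk0 := sun_H_gt0 gn0.
have ga : 0 < g k `^ alpha by rewrite powR_gt0.
have HSle : H k.+1 <= c * (g k)^-1 `^ (alpha - beta).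
  rewrite HS; case: j nacc {ystep sE acc HS} => [|j] nacc.
    by rewrite expr0 mul1r ler_pdivrMr// mulrC.
  have l0 : 0 < 4 ^+ j * H k * g k `^ alpha by rewrite !mulr_gt0// exprn_gt0.
  have [y ystep] := newton_step_exists df cf cpsi l0 (sun_subdifferential k).
  have := nacc j y (ltnSn j) ystep.
  apply: contra_notT; rewrite -ltNge exprS => lt.
  apply: (accM (sun_subdifferential k) l0 ystep).
  rewrite -/(g k) -cM -(beta_pow (ltW gk)) -exprMn -threshold//.
  rewrite lerXn2r ?nnegrE ?mulr_ge0 ?powR_ge0 ?(ltW Hk0) ?exprn_ge0//.
  rewrite ler_pM2r//; apply/ltW; apply: lt_le_trans lt _.
  by rewrite le_eqVlt; apply/orP; left; apply/eqP; field.
exists (4 ^+ j * H k * g k `^ alpha) => //.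
rewrite !mulr_gt0 ?exprn_gt0//= -threshold// mulrA ler_pM2r//.
by move: HSle; rewrite HS ler_pdivrMr// (mulrC _ 4).
Qed.

(** The bound obtained at step [k] involves [g k]. Since [g k.+1 <= 4 * g k] and [alpha - beta] lies
    in [[0, 1]], replacing [g k] by [g k.+1] costs at most a factor 4. *)
Lemma sun_H_le k : g k != 0 -> H k <= 4 * (c * (g k)^-1 `^ (alpha - beta)).
Proof.
elim: k => [g0|k IH gS].
  apply: le_trans H0c _; rewrite ler_peMl ?mulr_ge0 ?powR_ge0//.
  by rewrite ler1n.
have gk := sun_norm_neq0 gS.
have [lambda /andP[l0 _] [ystep sE acc HS]] := sun_step_bounds gk (IH gk).
apply: le_trans HS _; rewrite mulrCA ler_wpM2l//.
have g1 : g k.+1 <= 4 * g k.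
  have := accepts_norm_le df cf cpsi (sun_subdifferential k) l0 ystep acc.
  by rewrite -sE.
have gk0 := sun_norm_gt0 gk; have gS0 := sun_norm_gt0 gS.
have e0 : 0 <= alpha - beta by rewrite subr_ge0.
have b0 : 0 <= beta by rewrite divr_ge0.
apply: (@le_trans _ _ ((4 * (g k.+1)^-1) `^ (alpha - beta))).
  apply: ge0_ler_powR;
    rewrite ?nnegrE ?invr_ge0 ?mulr_ge0 ?invr_ge0 ?(ltW gk0) ?(ltW gS0)//.
  by rewrite ler_pdivlMr// ler_pdivrMl// mulrC.
rewrite powRM ?invr_ge0 ?(ltW gS0)// ler_wpM2r ?powR_ge0//.
rewrite -[leRHS]powRr1// ler_powR ?ler1n//.
by rewrite lerBlDr (le_trans alpha1)// lerDl.
Qed.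

Lemma sun_decrease k : g k != 0 -> exists2 lambda, 0 < lambda <= 4 * (c * g k `^ beta) &
  newton_step f psi (x k) lambda (x k.+1) /\
  g k.+1 ^+ 2 / (4 * lambda) <= F k - F k.+1.
Proof.
move=> gn0; have [lambda l [ystep sE acc _]] := sun_step_bounds gn0 (sun_H_le gn0).
exists lambda => //; split=> //.
have /andP[l0 _] := l.
have := accepts_decrease df cf cpsi (sun_subdifferential k) ystep acc.
by rewrite -sE.
Qed.

End regularization.
End trajectory.

(** * The gap to the optimal value and its decrease *)

Section convergence.
Context (R : realType) (E : vectType R) (B : spd_operator E).
Local Notation V := (euclidean B).
Variables (f : V -> R) (psi : V -> \bar R).
Hypotheses (df : times_differentiable 2 f) (cf : convex_function setT f).
Hypothesis cpsi : proper_closed_convex psi.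
Variables (alpha : R) (x : nat -> V) (dpsi : nat -> dual_space V) (H : nat -> R).
Hypothesis alg : super_universal_newton f psi alpha x dpsi H.

Let g k := dual_norm (gradient f (x k) + dpsi k).
Let F (z : V) := f z + fine (psi z).
Let F0 := sublevel f psi (x 0%N).
Let D := diameter F0.

Lemma objectiveE z : edom psi z -> objective f psi z = (F z)%:E.
Proof. by move=> zdom; rewrite /objective -(fineK (edom_fin_num cpsi zdom)). Qed.

Lemma sun_edom k : edom psi (x k).
Proof. by have [] := sun_subdifferential df cpsi alg k. Qed.

Lemma sun_nonincreasing k : F (x k.+1) <= F (x k).
Proof.
have [g0|gn0] := eqVneq (g k) 0; first by have [-> _] := sun_stop alg g0.
have [j [ystep _ acc _ _]] := sun_step alg gn0.
have l0 : 0 < 4 ^+ j * H k * g k `^ alpha.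
  rewrite mulr_gt0 ?powR_gt0 ?(sun_norm_gt0 gn0)//.
  by rewrite mulr_gt0 ?exprn_gt0// (sun_H_gt0 alg gn0).
have := accepts_decrease df cf cpsi (sun_subdifferential df cpsi alg k) ystep acc.
rewrite -(subr_ge0 (F _)); apply: le_trans.
by rewrite divr_ge0 ?sqr_ge0// mulr_ge0// ltW.
Qed.

Lemma sun_antitone i k : (i <= k)%N -> F (x k) <= F (x i).
Proof.
move=> /subnK <-; elim: (k - i)%N => // m IH.
by rewrite addSn (le_trans (sun_nonincreasing _)).
Qed.

Lemma sun_sublevel k : F0 (x k).
Proof.
split; first exact: sun_edom.
by rewrite !objectiveE; [rewrite lee_fin sun_antitone|exact: sun_edom..].
Qed.

Lemma objective_ge k z : edom psi z -> F (x k) - g k * `|z - x k| <= F z.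
Proof.
move=> zdom; have ss := sun_subdifferential df cpsi alg k.
have H1 := subdifferential_fine cpsi ss zdom.
have H2 := convex_gradient_le df cf (x k) z.
have := ler_dual_norm (gradient f (x k) + dpsi k) (z - x k).
rewrite ler_norml => /andP[+ _].
have -> : (gradient f (x k) + dpsi k) (z - x k) =
    gradient f (x k) (z - x k) + dpsi k (z - x k) :> R by rewrite add_lfunE.
rewrite -/(g k) /F; lra.
Qed.

Hypothesis F0b : bounded_set F0.

Lemma diameter_ge y z : F0 y -> F0 z -> `|y - z| <= D.
Proof.
move=> yF zF; apply: ub_le_sup; last by exists (y, z).
have [M [Mr MP]] := F0b.
have {}MP w : F0 w -> `|w| <= M + 1 by apply: MP; rewrite ltrDl.
exists ((M + 1) + (M + 1)) => _ [[a b] [/= aF bF] <-].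
by rewrite (le_trans (ler_normB _ _))// lerD// MP.
Qed.

Lemma diameter_ge0 : 0 <= D.
Proof.
exact: le_trans (normr_ge0 _) (diameter_ge (sun_sublevel 0) (sun_sublevel 0)).
Qed.

Lemma optimal_value_le k : (optimal_value f psi <= (F (x k))%:E)%E.
Proof.
apply: ereal_inf_lbound; exists (x k); first exact: sun_edom.
exact/objectiveE/sun_edom.
Qed.

(** A point of the domain outside the sublevel set has a value above that of [x 0], which belongs to
    the set. *)
Lemma optimal_value_ge (L : R) : (forall z, F0 z -> L <= F z) ->
  (L%:E <= optimal_value f psi)%E.
Proof.
move=> LP; apply/ereal_infP => _ [z zdom <-]; rewrite objectiveE// lee_fin.
have [le0|/ltW gt0] := leP (F z) (F (x 0%N)).
  apply: LP; split => //.
  by rewrite (objectiveE zdom) objectiveE ?lee_fin//; exact: sun_edom.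
exact: le_trans (LP _ (sun_sublevel 0)) gt0.
Qed.

Let Fopt := fine (optimal_value f psi).

Lemma optimal_valueE : optimal_value f psi = Fopt%:E.
Proof.
rewrite /Fopt fineK// fin_numE; apply/andP; split.
  have : ((F (x 0%N) - g 0%N * D)%:E <= optimal_value f psi)%E.
    apply: optimal_value_ge => z zF; apply: le_trans (objective_ge 0 zF.1).
    rewrite lerD2l lerN2 ler_wpM2l ?dual_norm_ge0//.
    exact: diameter_ge zF (sun_sublevel 0).
  by case: (optimal_value f psi).
by have := optimal_value_le 0; case: (optimal_value f psi).
Qed.

Definition gap_value k : R := F (x k) - Fopt.

Lemma gapE k : (objective f psi (x k) - optimal_value f psi)%E = (gap_value k)%:E.
Proof. by rewrite optimal_valueE objectiveE//; exact: sun_edom. Qed.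

Lemma gap_ge0 k : 0 <= gap_value k.
Proof. by rewrite subr_ge0 -lee_fin -optimal_valueE optimal_value_le. Qed.

(** Comparison with every point of the sublevel set stands in for comparison with a minimizer. *)
Lemma gap_le_of k (e : R) : (forall z, F0 z -> F (x k) <= F z + e) ->
  gap_value k <= e.
Proof.
move=> He; rewrite /gap_value lerBlDr addrC -lerBlDr -lee_fin -optimal_valueE.
by apply: optimal_value_ge => z /He; rewrite lerBlDr.
Qed.

Lemma gap_le k : gap_value k <= g k * D.
Proof.
apply: gap_le_of => z zF; rewrite -lerBlDr.
apply: le_trans (objective_ge k zF.1).
rewrite lerD2l lerN2 ler_wpM2l ?dual_norm_ge0//.
exact: diameter_ge zF (sun_sublevel k).
Qed.

Lemma gap_antitone i k : (i <= k)%N -> gap_value k <= gap_value i.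
Proof. by move=> ik; rewrite lerD2r sun_antitone. Qed.

(** Starting value for the recurrence of the case [q = 2]. The step minimizes the model, which
    differs from the objective by at most [M * D ^+ 2] at [x 1] and at [z], up to a constant and the
    regularization term. *)
Lemma gap_first_le (M lambda : R) : 0 <= M -> holder_constant f 2 0 = M%:E ->
  0 < lambda -> newton_step f psi (x 0%N) lambda (x 1%N) ->
  gap_value 1 <= (2 * M + lambda / 2) * D ^+ 2.
Proof.
have arith (fx fy fz q1 q2 r1 r2 p1 p2 m1 m2 m l d : R) :
    fy - fx - q1 <= m1 -> - m2 <= fz - fx - q2 ->
    q1 + r1 + p1 <= q2 + r2 + p2 -> m2 <= m * d -> m1 <= m * d ->
    r2 <= l / 2 * d -> 0 <= r1 ->
    fy + p1 <= fz + p2 + (2 * m + l / 2) * d.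
  lra.
move=> M0 Mf l0 ystep; apply: gap_le_of => z zF.
have zx : `|z - x 0%N| ^+ 2 <= D ^+ 2.
  rewrite lerXn2r ?nnegrE ?diameter_ge0//.
  exact: diameter_ge zF (sun_sublevel 0).
have yx : `|x 1%N - x 0%N| ^+ 2 <= D ^+ 2.
  rewrite lerXn2r ?nnegrE ?diameter_ge0//.
  exact: diameter_ge (sun_sublevel 1) (sun_sublevel 0).
have tay w : `|f w - f (x 0%N) - (gradient f (x 0%N) (w - x 0%N)
    + 2^-1 * hessian f (x 0%N) (w - x 0%N) (w - x 0%N))| <= M * `|w - x 0%N| ^+ 2.
  have := taylor2_le df (x 0%N) (w - x 0%N) M0 Mf.
  rewrite (addrC (x 0%N)) subrK gradientE; last exact: td_diff1.
  by rewrite hessianE// opprD addrA.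
have := ystep z; rewrite !newton_modelE.
rewrite -(fineK (edom_fin_num cpsi zF.1)) -(fineK (edom_fin_num cpsi (sun_edom 1))).
rewrite -!EFinD lee_fin /quadratic_model.
have := tay z; have := tay (x 1%N); rewrite !ler_norml => /andP[_ H1] /andP[H2 _] H3.
have H4 : M * `|z - x 0%N| ^+ 2 <= M * D ^+ 2 by rewrite ler_wpM2l.
have H5 : M * `|x 1%N - x 0%N| ^+ 2 <= M * D ^+ 2 by rewrite ler_wpM2l.
have H6 : lambda / 2 * `|z - x 0%N| ^+ 2 <= lambda / 2 * D ^+ 2.
  by rewrite ler_wpM2l// divr_ge0// ltW.
have H7 : 0 <= lambda / 2 * `|x 1%N - x 0%N| ^+ 2.
  by rewrite mulr_ge0 ?sqr_ge0// divr_ge0// ltW.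
exact: arith H1 H2 H3 H4 H5 H6 H7.
Qed.

Section rate.
Variables (n : nat) (M c : R).
Let beta : R := n%:R / n.+1%:R.
Hypotheses (beta_alpha : beta <= alpha) (alpha1 : alpha <= 1).
Hypotheses (c0 : 0 <= c) (cM : c ^+ n.+1 = 6 * M).
Hypothesis H0c : H 0%N <= c * (g 0%N)^-1 `^ (alpha - beta).
Hypothesis accM : forall z s lambda y, subdifferential psi z s -> 0 < lambda ->
  newton_step f psi z lambda y ->
  6 * M * dual_norm (gradient f z + s) ^+ n <= lambda ^+ n.+1 ->
  accepts f z lambda y.

(** The positive [H 0] lies below a multiple of [c]. *)
Lemma rate_const_gt0 : 0 < c.
Proof.
rewrite lt_def c0 andbT; apply/eqP => c00.
by have := le_trans H0c (lexx _); rewrite c00 mul0r leNgt (sun_H0 alg).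
Qed.

(** The factor 16 combines the 4 of the acceptance test with the 4 lost by the line search. *)
Lemma gap_decrease k : g k != 0 ->
  g k.+1 ^+ 2 <= 16 * (c * g k `^ beta) * (gap_value k - gap_value k.+1).
Proof.
move=> gn0; have [lambda /andP[l0 lle] [_ dec]] :=
  sun_decrease df cf cpsi alg beta_alpha alpha1 c0 cM H0c accM gn0.
have -> : gap_value k - gap_value k.+1 = F (x k) - F (x k.+1).
  by rewrite /gap_value; ring.
have F0' : 0 <= F (x k) - F (x k.+1) by rewrite subr_ge0 sun_nonincreasing.
move: dec; rewrite -/(F _) -/(F _) ler_pdivrMr ?mulr_gt0// mulrC => /le_trans.
apply; rewrite ler_wpM2r//; lra.
Qed.

(** [log_sum_rate] is applied to roots of order [n.+1], and its conclusion is raised to that power.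
    The bound [eps <= gap_value k] keeps all earlier gaps, the gradients and [D] positive, so that
    their logarithms are meaningful. *)
Lemma superlinear_gap_rate (k : nat) (eps : R) :
  0 < eps -> eps <= gap_value k -> 4 * ln (g 0%N * D / eps) <= k%:R ->
  k%:R ^+ n.+1 * gap_value k <= (32 * n.+1%:R) ^+ n.+1 * (6 * M) * D ^+ n.+2.
Proof.
move=> eps0 epsle logk.
have ak i : (i <= k)%N -> 0 < gap_value i.
  by move=> ik; apply: lt_le_trans eps0 (le_trans epsle (gap_antitone ik)).
have D0 : 0 < D.
  rewrite lt_def diameter_ge0 andbT; apply/eqP => D0.
  by have := gap_le k; rewrite D0 mulr0 leNgt ak.
have gk i : (i <= k)%N -> 0 < g i.
  by move=> /ak; have := gap_le i => /[swap]/lt_le_trans/[apply]; rewrite pmulr_lgt0.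
pose N : R := n.+1%:R; have N0 : 0 < N by rewrite ltr0Sn.
pose root (r : R) := r `^ N^-1.
have rootK r : 0 <= r -> root r ^+ n.+1 = r.
  move=> r0; rewrite /root -powR_mulrn ?powR_ge0// -powRrM mulVf ?powRr1//.
  by rewrite gt_eqF.
have root_gt0 r : 0 < r -> 0 < root r by exact: powR_gt0.
have rootM r r' : 0 <= r -> 0 <= r' -> root (r * r') = root r * root r'.
  exact: powRM.
have ln_root r : ln (root r) = N^-1 * ln r by exact: ln_powR.
have root_le r r' : 0 <= r -> r <= r' -> root r <= root r'.
  move=> r0 rr; apply: ge0_ler_powR; rewrite ?nnegrE ?invr_ge0 ?(ltW N0)//.
  exact: le_trans rr.
have gbeta i : (i <= k)%N -> g i `^ beta = root (g i) ^+ n.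
  move=> ik; rewrite /root -powR_mulrn ?powR_ge0// -powRrM.
  by congr (_ `^ _); rewrite /beta mulrC.
have c1 := rate_const_gt0.
have rate : k%:R * root (gap_value k) <= 2 * N * (16 * c) * root D ^+ n.+2.
  apply: (@log_sum_rate R (root \o gap_value) (root \o g) n k (16 * c) (root D)).
  - by rewrite mulr_gt0.
  - exact: root_gt0.
  - by move=> i /ak /root_gt0.
  - by move=> i /gk /root_gt0.
  - move=> i ik /=; rewrite -rootM ?(ltW D0) ?(ltW (gk _ ik))//.
    by apply: root_le; [exact/ltW/ak|exact: gap_le].
  - move=> i ik /=; have ik' := ltnW ik.
    rewrite mulnC exprM !rootK ?(ltW (ak _ _)) ?(ltW (gk _ _))//.
    have := gap_decrease (lt0r_neq0 (gk _ ik')).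
    by rewrite gbeta// mulrA.
  (* The factor [N] in the logarithmic condition cancels the [N^-1] coming from the logarithms of
     the roots. *)
  - have g0 := gk _ (leq0n k).
    rewrite /= -rootM ?(ltW D0) ?(ltW g0)// !ln_root -mulrBr -/N.
    rewrite -mulrA (mulrA N) divff ?gt_eqF// mul1r.
    apply: le_trans logk; rewrite ler_pM2l// ln_div ?posrE ?mulr_gt0//.
    by rewrite lerD2l lerN2 ler_ln ?posrE// ak.
have p0 : 0 <= k%:R * root (gap_value k) by rewrite mulr_ge0// powR_ge0.
have := rate; rewrite -(ler_pXn2r (ltn0Sn n)) ?nnegrE ?(le_trans p0 rate)//.
rewrite exprMn rootK ?(ltW (ak _ _))// => /le_trans; apply.
rewrite exprMn exprAC rootK ?(ltW D0)// -cM -exprMn -/N.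
by rewrite (_ : 2 * N * (16 * c) = 32 * N * c)//; ring.
Qed.

End rate.

End convergence.

(** * The three rates and the theorem *)

Section corollary.
Context (R : realType) (E : vectType R) (B : spd_operator E).
Local Notation V := (euclidean B).
Variables (f : V -> R) (psi : V -> \bar R).
Hypotheses (df : times_differentiable 2 f) (cf : convex_function setT f).
Hypothesis cpsi : proper_closed_convex psi.
Variables (alpha : R) (x : nat -> V) (dpsi : nat -> dual_space V) (H : nat -> R).
Hypothesis alg : super_universal_newton f psi alpha x dpsi H.
Hypothesis alpha_itv : 2 / 3 <= alpha <= 1.

Let g0 := dual_norm (gradient f (x 0%N) + dpsi 0%N).
Let F0 := sublevel f psi (x 0%N).
Let D := diameter F0.
Local Notation gap := (gap_value f psi x).

Hypotheses (g0_gt0 : 0 < g0) (H0c : ((H 0%N)%:E <= calH f alpha g0)%E).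
Hypothesis F0b : bounded_set F0.

(** The Riesz representative of the initial subgradient is nonzero because [g0] is positive; a
    nonzero vector excludes the value [-oo]. *)
Lemma smoothness_fin (q : R) : (smoothness f q < +oo)%E ->
  exists2 M : R, 0 <= M & smoothness f q = M%:E.
Proof.
have [y yE] := spd_op_surj (gradient f (x 0%N) + dpsi 0%N).
have y0 : y != 0.
  by apply: contraTneq g0_gt0 => y0; rewrite /g0 yE dual_norm_riesz y0 normr0 ltxx.
have : (0 <= smoothness f q)%E.
  by rewrite /smoothness; case: ifP => _; apply: holder_constant_ge0 y0.
by case: (smoothness f q) => [M|//|//]; rewrite lee_fin => M0 _; exists M.
Qed.

Lemma calH_le (M q : R) : 2 <= q <= 4 -> smoothness f q = M%:E ->
  H 0%N <= (6 * M) `^ (q - 1)^-1 * g0^-1 `^ (alpha - (q - 2) / (q - 1)).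
Proof.
move=> q24 Mq; rewrite -lee_fin; apply: le_trans H0c _.
apply: ereal_inf_lbound; exists q => //.
by rewrite Mq EFinM -(poweR_EFin (6 * M)) EFinM.
Qed.

Let root_pow (M : R) (n : nat) : 0 <= M ->
  ((6 * M) `^ n.+1%:R^-1) ^+ n.+1 = 6 * M.
Proof.
move=> M0; rewrite -powR_mulrn ?powR_ge0// -powRrM mulVf ?pnatr_eq0//.
by rewrite powRr1// mulr_ge0.
Qed.

(** The case [n = 2]: [beta = 2 / 3] is exactly the lower end of the range of [alpha]. *)
Lemma lipschitz_third_rate (M eps : R) (k : nat) : 0 <= M ->
  smoothness f 4 = M%:E -> 0 < eps -> eps <= gap k ->
  4 * ln (g0 * D / eps) <= k%:R ->
  k%:R ^+ 3 * gap k <= 6 * 96 ^+ 3 * M * D ^+ 4.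
Proof.
have /andP[alpha2 alpha1] := alpha_itv.
move=> M0 Mf eps0 epsle logk.
have Mf' : holder_constant f 3 1 = M%:E.
  rewrite -Mf /smoothness ltNge ler_nat /=; congr holder_constant; ring.
have rate : k%:R ^+ 3 * gap k <= (32 * 3%:R) ^+ 3 * (6 * M) * D ^+ 4.
  apply: (@superlinear_gap_rate _ _ _ _ _ df cf cpsi _ _ _ _ alg F0b 2 M
    ((6 * M) `^ 3^-1) alpha2 alpha1 (powR_ge0 _ _) (root_pow 2 M0) _ _ k eps
    eps0 epsle logk).
  - have := calH_le _ Mf.
    rewrite (_ : 4 - 1 = 3); last by ring.
    rewrite (_ : 4 - 2 = 2); last by ring.
    by apply; rewrite ler_nat lexx.
  - by move=> z s lambda y zs l0 ystep; exact: (accepts4 df cf cpsi zs l0 ystep M0 Mf').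
apply: le_trans rate _; rewrite (_ : 32 * 3%:R = 96); last by ring.
by rewrite [_ * (6 * M)]mulrCA (mulrA 6).
Qed.

Lemma bounded_third_rate (M eps : R) (k : nat) : 0 <= M ->
  smoothness f 3 = M%:E -> 0 < eps -> eps <= gap k ->
  4 * ln (g0 * D / eps) <= k%:R ->
  k%:R ^+ 2 * gap k <= 6 * 64 ^+ 2 * M * D ^+ 3.
Proof.
have /andP[alpha2 alpha1] := alpha_itv.
move=> M0 Mf eps0 epsle logk.
have Mf' : holder_constant f 3 0 = M%:E.
  by rewrite -Mf /smoothness ltxx subrr.
have alpha12 : 1 / 2 <= alpha by apply: le_trans alpha2; lra.
have rate : k%:R ^+ 2 * gap k <= (32 * 2%:R) ^+ 2 * (6 * M) * D ^+ 3.
  apply: (@superlinear_gap_rate _ _ _ _ _ df cf cpsi _ _ _ _ alg F0b 1 M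
    ((6 * M) `^ 2^-1) alpha12 alpha1 (powR_ge0 _ _) (root_pow 1 M0) _ _ k eps
    eps0 epsle logk).
  - have := calH_le _ Mf.
    rewrite (_ : 3 - 1 = 2); last by ring.
    rewrite (_ : 3 - 2 = 1); last by ring.
    by apply; rewrite !ler_nat.
  - by move=> z s lambda y zs l0 ystep; rewrite expr1;
      exact: (accepts3 df cf cpsi zs l0 ystep M0 Mf').
apply: le_trans rate _; rewrite (_ : 32 * 2%:R = 64); last by ring.
by rewrite [_ * (6 * M)]mulrCA (mulrA 6).
Qed.

Lemma bounded_hessian_rate (M : R) (k : nat) : 0 <= M ->
  smoothness f 2 = M%:E -> (1 <= k)%N -> k%:R * gap k <= 192 * M * D ^+ 2.
Proof.
have /andP[alpha2 alpha1] := alpha_itv.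
move=> M0 Mf k1.
have Mf' : holder_constant f 2 0 = M%:E.
  by rewrite -Mf /smoothness ltr_nat /= subrr.
have alpha0 : 0%:R / 1%:R <= alpha by apply: le_trans alpha2; lra.
have c0 : 0 <= 6 * M by rewrite mulr_ge0.
have H0 : H 0%N <= 6 * M * g0^-1 `^ (alpha - 0%:R / 1%:R).
  have := calH_le _ Mf.
  rewrite (_ : 2 - 1 = 1); last by ring.
  by rewrite subrr invr1 powRr1//; apply; rewrite lexx ler_nat.
have accM z s lambda y : subdifferential psi z s -> 0 < lambda ->
    newton_step f psi z lambda y ->
    6 * M * dual_norm (gradient f z + s) ^+ 0 <= lambda ^+ 1 ->
    accepts f z lambda y.
  by move=> zs l0 ystep; rewrite expr0 mulr1 expr1; exact: (accepts2 df z y l0 M0 Mf').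
have dec := @gap_decrease _ _ _ _ _ df cf cpsi _ _ _ _ alg 0 M (6 * M)
  alpha0 alpha1 c0 (expr1 _) H0 accM.
have D0 : 0 <= D by exact: (diameter_ge0 df cf cpsi alg F0b).
have a0 i : 0 <= gap i by exact: (gap_ge0 df cf cpsi alg F0b).
have agD i : gap i <= dual_norm (gradient f (x i) + dpsi i) * D.
  exact: (gap_le df cf cpsi alg F0b).
(* [sublinear_rate] asks for a positive [K]; when [D = 0] the gap vanishes. *)
have [D00|Dn0] := eqVneq D 0.
  have -> : gap k = 0.
    by apply/eqP; rewrite eq_le a0 andbT; have := agD k; rewrite D00 mulr0.
  by rewrite D00 expr0n !mulr0.
have Dgt0 : 0 < D by rewrite lt_def Dn0.
have M1 : 0 < M.
  have := rate_const_gt0 (n := 0) alg c0 H0.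
  by rewrite pmulr_rgt0.
(* 96 is the 16 of [gap_decrease] times the 6 in [c = 6 * M]; the extra [D ^+ 2] comes from
   [gap <= g * D]. *)
have K0 : 0 < 96 * M * D ^+ 2 by rewrite !mulr_gt0 ?exprn_gt0.
rewrite mulrC -ler_pdivlMr ?ltr0n//.
rewrite (_ : 192 * M * D ^+ 2 = 2 * (96 * M * D ^+ 2)); last by ring.
apply: (sublinear_rate (a := gap)) => // [|i].
(* Here [lambda <= 24 * M], so the first gap is at most [14 * M * D ^+ 2], well below [2 * K]. *)
- have [lambda /andP[l0 lle] [ystep _]] := @sun_decrease _ _ _ _ _ df cf cpsi
    _ _ _ _ alg 0 M (6 * M) alpha0 alpha1 c0 (expr1 _) H0 accM 0%N
    (lt0r_neq0 g0_gt0).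
  apply: le_trans (gap_first_le df cf cpsi alg F0b M0 Mf' l0 ystep) _.
  rewrite mulrA ler_wpM2r ?sqr_ge0//.
  move: lle; rewrite mul0r powRr0 mulr1; lra.
- have [gi0|gin0] := eqVneq (dual_norm (gradient f (x i) + dpsi i)) 0.
    have [xi si] := sun_stop alg gi0.
    have gap0 : gap i.+1 = 0.
      apply/eqP; rewrite eq_le a0 andbT; have := agD i.+1.
      by rewrite xi si gi0 mul0r.
    by rewrite gap0 expr0n subr0 mulr_ge0// ltW.
  have := dec i gin0; rewrite mul0r powRr0 mulr1.
  have : gap i.+1 ^+ 2 <= (dual_norm (gradient f (x i.+1) + dpsi i.+1) * D) ^+ 2.
    by rewrite ler_pXn2r ?nnegrE// mulr_ge0// dual_norm_ge0.
  rewrite exprMn => /le_trans H1 H2; apply: H1.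
  have := ler_wpM2r (sqr_ge0 D) H2; lra.
Qed.

End corollary.

(** [C] is chosen before the space and all data, hence absolute. The first two rates concern
    iterates with gap at least [eps], the alternative being that accuracy [eps] is reached: the
    condition on [k] then controls the logarithm of [g0 * D / gap]. *)
Theorem corollary2 (R : realType) :
  exists C : R, 0 < C /\
  forall (E : vectType R) (B : spd_operator E)
    (f : euclidean B -> R) (psi : euclidean B -> \bar R)
    (alpha : R) (x : nat -> euclidean B) (dpsi : nat -> dual_space (euclidean B))
    (H : nat -> R),
  convex_function setT f ->
  times_differentiable 2 f ->
  proper_closed_convex psi ->
  2 / 3 <= alpha <= 1 ->
  super_universal_newton f psi alpha x dpsi H ->
  let g0 := dual_norm (gradient f (x 0%N) + dpsi 0%N) in
  let F0 := sublevel f psi (x 0%N) in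
  let D := diameter F0 in
  let gap k := (objective f psi (x k) - optimal_value f psi)%E in
  0 < g0 ->
  ((H 0%N)%:E <= calH f alpha g0)%E ->
  bounded_set F0 ->
  forall (eps : R) (k : nat),
  0 < eps -> (1 <= k)%N -> 4 * ln (g0 * D / eps) <= k%:R ->
  [/\ (smoothness f 4 < +oo)%E -> (eps%:E <= gap k)%E ->
        (gap k <= C%:E * (smoothness f 4 * (D ^+ 4 / k%:R ^+ 3)%:E))%E,
      (smoothness f 3 < +oo)%E -> (eps%:E <= gap k)%E ->
        (gap k <= C%:E * (smoothness f 3 * (D ^+ 3 / k%:R ^+ 2)%:E))%E
    & (smoothness f 2 < +oo)%E ->
        (gap k <= C%:E * (smoothness f 2 * (D ^+ 2 / k%:R)%:E))%E].
Proof.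
pose C4 : R := 6 * 96 ^+ 3; pose C3 : R := 6 * 64 ^+ 2.
have C40 : 0 < C4 by rewrite mulr_gt0// exprn_gt0.
have C30 : 0 < C3 by rewrite mulr_gt0// exprn_gt0.
exists (C4 + C3 + 192); split; first by rewrite !addr_gt0.
move=> E B f psi alpha x dpsi H cf df cpsi alpha_itv alg g0 F0 D gap g0_gt0 H0c
  F0b eps k eps0 k1 logk.
have k0 : 0 < k%:R :> R by rewrite ltr0n.
have gE : gap k = (gap_value f psi x k)%:E by exact: (gapE df cf cpsi alg F0b).
have D0 : 0 <= D by exact: (diameter_ge0 df cf cpsi alg F0b).
have weaken (c C M d a : R) (m : nat) : c <= C -> 0 <= M -> 0 <= d ->
    k%:R ^+ m * a <= c * M * d -> a <= C * (M * (d / k%:R ^+ m)).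
  move=> c1 M0 d0; rewrite !mulrA ler_pdivlMr ?exprn_gt0// mulrC => /le_trans; apply.
  by apply: ler_wpM2r => //; apply: ler_wpM2r.
rewrite gE; split.
- move=> /(smoothness_fin g0_gt0)[M M0 Mf]; rewrite lee_fin => epsle.
  rewrite Mf -!EFinM lee_fin; apply: (@weaken C4) => //.
  + by rewrite -addrA lerDl addr_ge0// ltW.
  + exact: exprn_ge0.
  + exact: (lipschitz_third_rate df cf cpsi alg alpha_itv H0c F0b M0 Mf eps0
      epsle logk).
- move=> /(smoothness_fin g0_gt0)[M M0 Mf]; rewrite lee_fin => epsle.
  rewrite Mf -!EFinM lee_fin; apply: (@weaken C3) => //.
  + by rewrite (addrC C4) -addrA lerDl addr_ge0// ltW.
  + exact: exprn_ge0.
  + exact: (bounded_third_rate df cf cpsi alg alpha_itv H0c F0b M0 Mf eps0 epsle logk).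
- move=> /(smoothness_fin g0_gt0)[M M0 Mf].
  rewrite Mf -!EFinM lee_fin -(expr1 k%:R); apply: (@weaken 192) => //.
  + by rewrite lerDr addr_ge0// ltW.
  + exact: exprn_ge0.
  + rewrite expr1.
    exact: (bounded_hessian_rate df cf cpsi alg alpha_itv g0_gt0 H0c F0b M0 Mf k1).
Qed.
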